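(* Let $G$ be a cograph, and let $s$ be an integer with $s \ge 2$. Then $G$ is a cograph minimal $(s,1)$-polar obstruction if and only if it is (isomorphic to) one of the following: (1) one of the four essential obstructions $K_1 + 2K_2$, $\overline{K_2} + C_4$, $2P_3$, $K_1 + (\overline{P_3} \oplus \overline{K_2})$; (2) $2K_{s+1}$; (3) $K_2 + (\overline{K_2} \oplus K_s)$; (4) $K_1 + (C_4 \oplus K_{s-1})$; (5) $\overline{(s+1)K_2}$; (6) a graph $G$ whose complement is disconnected with connected components $G_1, \dots, G_t$, such that $t \le s$ and there exist non-negative integers $s_1, \dots, s_t$ such that, for each $i \in \{1,\dots,t\}$, $G_i$ is the complement of a non-essential disconnected cograph minimal $(s_i,1)$-polar obstruction, and $\sum_{i=1}^t s_i = s - t + 1$.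
   Context: All graphs are finite and simple. A cograph is a graph with no induced path $P_4$ on four vertices. $G+H$ denotes disjoint union, $nG$ the disjoint union of $n$ copies of $G$, $G \oplus H$ the join (disjoint union plus all edges between $G$ and $H$), and $\overline{G}$ the complement. $P_k$ and $C_k$ are the path and cycle on $k$ vertices. For non-negative integers $s,k$, a graph $G$ is $(s,k)$-polar if $V(G)$ admits a partition $(A,B)$ (parts may be empty) such that $A$ induces a complete multipartite graph with at most $s$ parts, and $B$ induces a disjoint union of at most $k$ cliques with no other edges (i.e. the complement of a complete multipartite graph with at most $k$ parts). A cograph minimal $(s,k)$-polar obstruction is a cograph that is not $(s,k)$-polar but all of whose proper induced subgraphs are $(s,k)$-polar. The essential obstructions are the four graphs $K_1 + 2K_2$, $\overline{K_2} + C_4$, $2P_3$ and $K_1 + (\overline{P_3} \oplus \overline{K_2})$; a graph isomorphic to none of them is non-essential. *)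

(* Defs.v *)
From mathcomp Require Import all_boot.

Set Implicit Arguments.
Unset Strict Implicit.
Unset Printing Implicit Defensive.

Record sgraph := SGraph {
  vertex :> finType;
  edge : rel vertex;
  edge_sym : symmetric edge;
  edge_irrefl : irreflexive edge }.

Notation "x -- y" := (edge x y) (at level 30, no associativity).

Section Operations.
Variables (n : nat) (G H : sgraph).

Definition complement_rel : rel G := fun x y => (x != y) && ~~ (x -- y).

Fact complement_sym : symmetric complement_rel.
Proof. by move=> x y; rewrite /complement_rel eq_sym edge_sym. Qed.

Fact complement_irrefl : irreflexive complement_rel.
Proof. by move=> x; rewrite /complement_rel eqxx. Qed.

Definition complement : sgraph := SGraph complement_sym complement_irrefl.

Definition induced_rel (S : {set G}) : rel {x : G | x \in S} :=
  fun x y => val x -- val y.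

Fact induced_sym (S : {set G}) : symmetric (@induced_rel S).
Proof. by move=> x y; exact: edge_sym. Qed.

Fact induced_irrefl (S : {set G}) : irreflexive (@induced_rel S).
Proof. by move=> x; exact: edge_irrefl. Qed.

Definition induced (S : {set G}) : sgraph :=
  SGraph (@induced_sym S) (@induced_irrefl S).

Definition disjoint_union_rel : rel (G + H) := fun u v =>
  match u, v with
  | inl x, inl y => x -- y
  | inr x, inr y => x -- y
  | _, _ => false
  end.

Fact disjoint_union_sym : symmetric disjoint_union_rel.
Proof. by move=> [x|x] [y|y] //=; exact: edge_sym. Qed.

Fact disjoint_union_irrefl : irreflexive disjoint_union_rel.
Proof. by move=> [x|x]; exact: edge_irrefl. Qed.

Definition disjoint_union : sgraph :=
  SGraph disjoint_union_sym disjoint_union_irrefl.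

Definition join_rel : rel (G + H) := fun u v =>
  match u, v with
  | inl x, inl y => x -- y
  | inr x, inr y => x -- y
  | _, _ => true
  end.

Fact join_sym : symmetric join_rel.
Proof. by move=> [x|x] [y|y] //=; exact: edge_sym. Qed.

Fact join_irrefl : irreflexive join_rel.
Proof. by move=> [x|x]; exact: edge_irrefl. Qed.

Definition join : sgraph := SGraph join_sym join_irrefl.

Definition copies_rel : rel ('I_n * G) :=
  fun u v => (u.1 == v.1) && (u.2 -- v.2).

Fact copies_sym : symmetric copies_rel.
Proof. by move=> u v; rewrite /copies_rel eq_sym edge_sym. Qed.

Fact copies_irrefl : irreflexive copies_rel.
Proof. by move=> u; rewrite /copies_rel edge_irrefl andbF. Qed.

Definition copies : sgraph := SGraph copies_sym copies_irrefl.

End Operations.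

Section Families.
Variable n : nat.

Definition complete_rel : rel 'I_n := fun i j => i != j.

Fact complete_sym : symmetric complete_rel.
Proof. by move=> i j; rewrite /complete_rel eq_sym. Qed.

Fact complete_irrefl : irreflexive complete_rel.
Proof. by move=> i; rewrite /complete_rel eqxx. Qed.

Definition complete : sgraph := SGraph complete_sym complete_irrefl.

Definition path_rel : rel 'I_n := fun i j => (i.+1 == j) || (j.+1 == i).

Fact path_sym : symmetric path_rel.
Proof. by move=> i j; rewrite /path_rel orbC. Qed.

Fact path_irrefl : irreflexive path_rel.
Proof. by move=> i; rewrite /path_rel orbb eqn_leq ltnn. Qed.

Definition path_graph : sgraph := SGraph path_sym path_irrefl.

(* The conjunct [i != j] only matters for the degenerate case n = 1. *)
Definition cycle_rel : rel 'I_n :=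
  fun i j => (i != j) && ((i.+1 %% n == j) || (j.+1 %% n == i)).

Fact cycle_sym : symmetric cycle_rel.
Proof. by move=> i j; rewrite /cycle_rel eq_sym orbC. Qed.

Fact cycle_irrefl : irreflexive cycle_rel.
Proof. by move=> i; rewrite /cycle_rel eqxx. Qed.

Definition cycle_graph : sgraph := SGraph cycle_sym cycle_irrefl.

End Families.

Definition isomorphic (G H : sgraph) : Prop :=
  exists f : G -> H, bijective f /\ forall x y, (f x -- f y) = (x -- y).

Definition contains_induced (G H : sgraph) : Prop :=
  exists f : H -> G, injective f /\ forall x y, (f x -- f y) = (x -- y).

Definition cograph (G : sgraph) : Prop := ~ contains_induced G (path_graph 4).

Definition connected (G : sgraph) : Prop :=
  forall x y : G, connect (@edge G) x y.

Definition disconnected (G : sgraph) : Prop := ~ connected G.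

Definition components (G : sgraph) : {set {set G}} :=
  equivalence_partition (connect (@edge G)) [set: G].

(* The blocks of a [partition] are nonempty, so #|P| is the number of parts;
   the graph without vertices has zero parts. *)
Definition complete_multipartite (s : nat) (G : sgraph) : Prop :=
  exists P : {set {set G}},
    [/\ partition P [set: G], #|P| <= s
      & forall x y : G, (x -- y) = (pblock P x != pblock P y)].

Definition union_of_cliques (k : nat) (G : sgraph) : Prop :=
  exists P : {set {set G}},
    [/\ partition P [set: G], #|P| <= k
      & forall x y : G, (x -- y) = (x != y) && (pblock P x == pblock P y)].

Definition polar (s k : nat) (G : sgraph) : Prop :=
  exists A : {set G},
    complete_multipartite s (induced A) /\ union_of_cliques k (induced (~: A)).

Definition minimal_polar_obstruction (s k : nat) (G : sgraph) : Prop :=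
  [/\ cograph G, ~ polar s k G
    & forall S : {set G}, S \proper [set: G] -> polar s k (induced S)].

Definition essential (G : sgraph) : Prop :=
  [\/ isomorphic G (disjoint_union (complete 1) (copies 2 (complete 2))),
      isomorphic G (disjoint_union (complement (complete 2)) (cycle_graph 4)),
      isomorphic G (copies 2 (path_graph 3))
    | isomorphic G
        (disjoint_union (complete 1)
           (join (complement (path_graph 3)) (complement (complete 2))))].

(* Here t = #|components (complement G)|, and the integers s_1, ..., s_t are
   indexed by the vertex sets of the components themselves. *)
Definition join_of_obstructions (s : nat) (G : sgraph) : Prop :=
  [/\ disconnected (complement G),
      #|components (complement G)| <= s
    & exists s_ : {set complement G} -> nat,
        (forall C, C \in components (complement G) ->
           exists H : sgraph,
             [/\ isomorphic (induced C) (complement H),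
                 ~ essential H,
                 disconnected H
               & minimal_polar_obstruction (s_ C) 1 H]) /\
        \sum_(C in components (complement G)) s_ C
          = s - #|components (complement G)| + 1].

(* Main.v *)
Require Import Defs.
From mathcomp Require Import all_boot zify.

(* A vertex set S is (s,1)-polar iff it contains some A inducing a complete
   multipartite graph (non-adjacency is transitive on A) without (s+1)-cliques
   and such that S \ A is a clique; this formulation avoids partitions.  Every
   P4-free graph with two vertices splits into two nonempty sides with no edges
   or all edges between them.

   If there are no edges, a polar partition either consists of an independent
   set and a clique, or has its two classes equal to the two sides; a case
   analysis on whether the sides contain an edge, co-P3, C4 or 2K2 then exhibits
   one of the essential obstructions or of the three families (2)-(4), all of
   which are non-polar, so minimality turns containment into isomorphism.

   If all edges are present, cliques of A add up over the co-components C, so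
   the least m(C) for which C is (m(C),1)-polar is additive.  Removing a vertex
   of C must therefore lower m(C), i.e. C is a minimal (m(C)-1,1)-obstruction,
   and the sum of the m(C) is exactly s+1 because a disconnected obstruction is
   minimal for at most one parameter. *)

Set Implicit Arguments.
Unset Strict Implicit.
Unset Printing Implicit Defensive.

(** * Polarity of vertex sets *)

(** The integers in (6) may be 0 or 1, so the analysis of disconnected graphs has to cover every
    positive parameter, where the families (2)-(4) need not be minimal, and the parameter 0, where
    polar means clique. It therefore yields only containment of a listed graph; that the listed
    graphs are themselves minimal is proved separately, for [s >= 2]. The four essential graphs are
    polar for no parameter at all. Hence a graph that is polar for some parameter is not essential,
    which accounts for the word non-essential in (6). In the absence of essential graphs, a family
    member for [s + 1] contains a strictly smaller member for [s] when [s] is positive; this is why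
    a non-essential disconnected graph is not minimal for two parameters. With t co-components, the
    integers of (6) are m(C) - 1 and add up to s + 1 - t. Every m(C) is positive, so t is at most s
    + 1, and the extreme case t = s + 1 is item (5). *)

Section Polarity.
Variable G : sgraph.
Implicit Types (x y z : G) (A B C K S X Y : {set G}).

Definition clique K := [forall x in K, forall y in K, (x != y) ==> (x -- y)].

Lemma cliqueP K :
  reflect (forall x y, x \in K -> y \in K -> x != y -> x -- y) (clique K).
Proof.
apply: (iffP idP) => [cK x y xK yK xy|cK].
  by move/forall_inP: cK => /(_ x xK)/forall_inP/(_ y yK)/implyP; exact.
apply/forall_inP => x xK; apply/forall_inP => y yK; apply/implyP.
exact: cK.
Qed.

Lemma subclique K X : K \subset X -> clique X -> clique K.
Proof.
move=> sKX /cliqueP cX; apply/cliqueP => x y xK yK.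
by apply: cX; exact: (subsetP sKX).
Qed.

Definition multipartite A :=
  [forall x in A, forall y in A, forall z in A,
     ~~ (x -- y) ==> ~~ (y -- z) ==> ~~ (x -- z)].

Lemma multipartiteP A :
  reflect (forall x y z, x \in A -> y \in A -> z \in A ->
             ~~ (x -- y) -> ~~ (y -- z) -> ~~ (x -- z)) (multipartite A).
Proof.
apply: (iffP idP) => [mA x y z xA yA zA xy yz|mA].
  move/forall_inP: mA => /(_ x xA)/forall_inP/(_ y yA)/forall_inP/(_ z zA).
  by rewrite xy yz.
apply/forall_inP => x xA; apply/forall_inP => y yA; apply/forall_inP => z zA.
by apply/implyP => xy; apply/implyP; exact: (mA x y z).
Qed.

Lemma submultipartite A X : A \subset X -> multipartite X -> multipartite A.
Proof.
move=> sAX /multipartiteP mX; apply/multipartiteP => x y z xA yA zA.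
by apply: mX; exact: (subsetP sAX).
Qed.

Lemma nonmultipartiteP A :
  reflect (exists x y z, [/\ x \in A, y \in A & z \in A] /\
             [/\ ~~ (x -- y), ~~ (y -- z) & x -- z])
          (~~ multipartite A).
Proof.
apply: (iffP idP) => [|[x [y [z [[xA yA zA] [xy yz xz]]]]]]; last first.
  by apply/multipartiteP => /(_ x y z xA yA zA xy yz); rewrite xz.
rewrite negb_forall_in => /exists_inP[x xA].
rewrite negb_forall_in => /exists_inP[y yA].
rewrite negb_forall_in => /exists_inP[z zA].
rewrite !negb_imply andbT => /and3P[xy yz xz].
by exists x, y, z.
Qed.

Lemma noncliqueP K :
  reflect (exists x y, [/\ x \in K, y \in K, x != y & ~~ (x -- y)])
          (~~ clique K).
Proof.
apply: (iffP idP) => [|[x [y [xK yK nxy xy]]]]; last first.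
  by apply/cliqueP => /(_ x y xK yK nxy); rewrite (negPf xy).
rewrite negb_forall_in => /exists_inP[x xK].
rewrite negb_forall_in => /exists_inP[y yK].
by rewrite negb_imply => /andP[xy nxy]; exists x, y.
Qed.

(** One maximum clique is fixed, not only its size, so that maximum cliques of different
    co-components can later be glued into one clique. *)
Definition max_clique A : {set G} :=
  [arg max_(K > set0 | (K \subset A) && clique K) #|K|].

Definition omega A := #|max_clique A|.

Lemma max_cliqueP A :
  [/\ max_clique A \subset A, clique (max_clique A)
    & forall K, K \subset A -> clique K -> #|K| <= omega A].
Proof.
rewrite /omega /max_clique; case: arg_maxnP => [|K /andP[sKA cK] maxK].
  by rewrite sub0set; apply/cliqueP => x y; rewrite inE.
by split=> // K' sK' cK'; apply: maxK; rewrite sK'.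
Qed.

Lemma omega_leP s A :
  reflect (forall K, K \subset A -> clique K -> #|K| <= s) (omega A <= s).
Proof.
have [sM cM maxM] := max_cliqueP A.
apply: (iffP idP) => [le_s K sK cK|]; last exact.
by apply: leq_trans le_s; exact: maxM.
Qed.

Lemma omega_leS A X : A \subset X -> omega A <= omega X.
Proof.
move=> sAX; have [sM cM _] := max_cliqueP A; have [_ _] := max_cliqueP X.
by apply=> //; exact: subset_trans sAX.
Qed.

Definition polar_witness s S A :=
  [&& A \subset S, multipartite A, omega A <= s & clique (S :\: A)].

Definition polar_set s S := [exists A, polar_witness s S A].

Lemma polar_setP s S :
  reflect (exists A, polar_witness s S A) (polar_set s S).
Proof. exact: existsP. Qed.

Lemma polar_setS s S X : X \subset S -> polar_set s S -> polar_set s X.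
Proof.
move=> sXS /polar_setP[A /and4P[sAS mA oA cB]]; apply/polar_setP.
exists (A :&: X); apply/and4P; split; first exact: subsetIr.
- by apply: submultipartite mA; exact: subsetIl.
- by apply: leq_trans oA; apply: omega_leS; exact: subsetIl.
apply: subclique cB; apply/subsetP => x; rewrite !inE => /andP[nA xX].
by move: nA; rewrite xX andbT (subsetP sXS _ xX) andbT.
Qed.

Lemma leq_polar_set s s' S : s <= s' -> polar_set s S -> polar_set s' S.
Proof.
move=> le_ss' /polar_setP[A /and4P[sAS mA oA cB]]; apply/polar_setP.
by exists A; apply/and4P; split=> //; apply: leq_trans le_ss'.
Qed.

Lemma polar_clique s S : clique S -> polar_set s S.
Proof.
move=> cS; apply/polar_setP; exists set0; apply/and4P; split.
- exact: sub0set.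
- by apply/multipartiteP => x; rewrite inE.
- by apply/omega_leP => K; rewrite subset0 => /eqP->; rewrite cards0.
- by rewrite setD0.
Qed.

(** A single vertex is already a clique of size 1, so parameter 0 forces the multipartite class to
    be empty. *)
Lemma polar_set0 S : polar_set 0 S = clique S.
Proof.
apply/idP/idP; last exact: polar_clique.
case/polar_setP=> A /and4P[sAS mA /omega_leP oA cB].
suff A0: A = set0 by rewrite A0 setD0 in cB.
apply/setP => x; rewrite inE; apply/negP => xA.
have := oA [set x]; rewrite sub1set cards1 => /(_ xA).
have cx: clique [set x].
  by apply/cliqueP => y z /set1P-> /set1P->; rewrite eqxx.
by move/(_ cx).
Qed.

(* One function encodes both classes: the values below [s] are the parts of
   the multipartite class, the other vertices form the clique. *)
Lemma polar_setD1_colour s v (c : G -> nat) :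
  (forall x y, x != v -> y != v -> x != y ->
     if (c x < s) && (c y < s) then (x -- y) = (c x != c y)
     else (s <= c x) && (s <= c y) ==> (x -- y)) ->
  polar_set s (setT :\ v).
Proof.
move=> cP; apply/polar_setP; exists [set x | (x != v) && (c x < s)].
apply/and4P; split.
- by apply/subsetP => x; rewrite !inE andbT => /andP[].
- have eqc x y : x != v -> y != v -> c x < s -> c y < s ->
      (x -- y) = (c x != c y).
    move=> xv yv cx cy; case: (eqVneq x y) => [->|xy].
      by rewrite edge_irrefl eqxx.
    by have := cP x y xv yv xy; rewrite cx cy.
  apply/multipartiteP => x y z; rewrite !inE => /andP[xv cx] /andP[yv cy].
  by case/andP=> zv cz; rewrite !eqc // !negbK => /eqP-> /eqP->.
- apply/omega_leP => K /subsetP sK /cliqueP cK; rewrite cardE -(size_map c).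
  rewrite -[leqRHS](size_iota 0); apply: uniq_leq_size.
    rewrite map_inj_in_uniq ?enum_uniq // => x y; rewrite !mem_enum => xK yK.
    move=> cxy; apply/eqP; apply: contraTT isT => nxy.
    move: (sK _ xK) (sK _ yK); rewrite !inE => /andP[xv cx] /andP[yv cy].
    have := cP x y xv yv nxy; rewrite cx cy /= cxy eqxx.
    by rewrite (cK _ _ xK yK nxy).
  move=> i /mapP[x]; rewrite mem_enum => /sK; rewrite inE => /andP[_ cx] ->.
  by rewrite mem_iota.
apply/cliqueP => x y; rewrite !inE !andbT => /andP[nx xv] /andP[ny yv] xy.
move: nx ny; rewrite xv yv /= -!leqNgt => cx cy.
by have := cP x y xv yv xy; rewrite ltnNge cx cy.
Qed.

(* In a complete multipartite set, a clique meets each part at most once. *)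
Lemma clique_meets_part A K a : multipartite A -> K \subset A -> clique K ->
  a \in A -> #|K| <= #|[set x in K | x -- a]|.+1.
Proof.
move=> /multipartiteP mA /subsetP sKA /cliqueP cK aA.
rewrite -(cardsID [set x | x -- a] K) -[leqRHS]addn1.
apply: leq_add; first by apply: subset_leq_card; apply/subsetP=> x; rewrite !inE.
apply/card_le1_eqP => x y; rewrite !inE => /andP[xa xK] /andP[ya yK].
apply/eqP; apply: contraTT isT => nxy.
have := cK _ _ xK yK; rewrite eq_sym => /(_ nxy).
apply/contraTT => _.
apply: (mA x a y) => //; [exact: sKA|exact: sKA|by rewrite edge_sym].
Qed.

End Polarity.

(** * Invariance of polarity under embeddings *)

Section Embedding.
Variables (G H : sgraph) (f : H -> G).
Hypotheses (f_inj : injective f) (f_edge : forall x y, (f x -- f y) = (x -- y)).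
Implicit Types (A K S : {set H}).

Lemma clique_imset K : clique (f @: K) = clique K.
Proof.
apply/cliqueP/cliqueP => [cK x y xK yK|cK _ _ /imsetP[x xK ->] /imsetP[y yK ->]].
  by rewrite -(inj_eq f_inj) -f_edge; apply: cK; exact: imset_f.
by rewrite (inj_eq f_inj) f_edge; exact: cK.
Qed.

Lemma multipartite_imset A : multipartite (f @: A) = multipartite A.
Proof.
apply/multipartiteP/multipartiteP => [mA x y z xA yA zA|mA x' y' z'].
  by rewrite -!f_edge; apply: mA; exact: imset_f.
move=> /imsetP[x xA ->] /imsetP[y yA ->] /imsetP[z zA ->].
by rewrite !f_edge; exact: mA.
Qed.

Lemma imset_preimset_sub (B : {set G}) A : B \subset f @: A ->
  f @: (f @^-1: B) = B.
Proof.
move=> /subsetP sB; apply/setP => y; apply/idP/idP => [/imsetP[x]|yB].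
  by rewrite inE => xB ->.
have /imsetP[x _ yE] := sB y yB.
by rewrite yE imset_f // inE -yE.
Qed.

Lemma omega_imset A : omega (f @: A) = omega A.
Proof.
apply/eqP; rewrite eqn_leq; apply/andP; split; apply/omega_leP => K sK cK.
  have [_ _ maxA] := max_cliqueP A.
  rewrite -(imset_preimset_sub sK) card_imset //; apply: maxA.
    apply/subsetP => x; rewrite inE => /(subsetP sK)/imsetP[y yA].
    by move/f_inj->.
  by rewrite -clique_imset (imset_preimset_sub sK).
have [_ _ maxA] := max_cliqueP (f @: A).
rewrite -(card_imset _ f_inj); apply: maxA; first exact: imsetS.
by rewrite clique_imset.
Qed.

Lemma polar_set_imset s S : polar_set s (f @: S) = polar_set s S.
Proof.
apply/polar_setP/polar_setP => -[A /and4P[sAS mA oA cB]].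
  have fA := imset_preimset_sub sAS.
  exists (f @^-1: A); apply/and4P; split.
  - apply/subsetP => x; rewrite inE => /(subsetP sAS)/imsetP[y yA].
    by move/f_inj->.
  - by rewrite -multipartite_imset fA.
  - by rewrite -omega_imset fA.
  rewrite -clique_imset; apply: subclique cB; apply/subsetP => y /imsetP[x].
  by rewrite !inE => /andP[nA xS] ->; rewrite nA imset_f.
exists (f @: A); apply/and4P; split; first exact: imsetS.
- by rewrite multipartite_imset.
- by rewrite omega_imset.
rewrite -clique_imset in cB; apply: subclique cB; apply/subsetP => y.
rewrite inE => /andP[nA /imsetP[x xS yE]]; rewrite yE imset_f // inE xS andbT.
by apply: contra nA => xA; rewrite yE imset_f.
Qed.

End Embedding.

(** * Agreement with the definitions by partitions *)

(** A clique has at most one vertex in each part and a transversal of the parts is a clique, so the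
    clique number counts the parts. The parts are recovered as the classes of non-adjacency. *)
Lemma complete_multipartiteP s (G : sgraph) :
  complete_multipartite s G <->
  multipartite [set: G] /\ omega [set: G] <= s.
Proof.
split=> [[P [partP leP eP]]|[/multipartiteP mG /omega_leP oG]].
  have [/eqP covP _ _] := and3P partP.
  split.
    by apply/multipartiteP => x y z _ _ _; rewrite !eP !negbK => /eqP-> /eqP->.
  apply/omega_leP => K _ /cliqueP cK; apply: leq_trans leP.
  rewrite -(card_in_imset (f := pblock P)) => [|x y xK yK pxy].
    apply: subset_leq_card; apply/subsetP => _ /imsetP[x _ ->].
    by apply: pblock_mem; rewrite covP inE.
  by apply/eqP; apply: contraTT isT => /(cK _ _ xK yK); rewrite eP pxy eqxx.
pose R := [rel x y : G | ~~ (x -- y)].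
have eqR : {in [set: G] & &, equivalence_rel R}.
  move=> x y z _ _ _ /=; split=> [|nxy]; first by rewrite edge_irrefl.
  by apply/idP/idP; apply: mG; rewrite ?inE // edge_sym.
have partP := equivalence_partitionP eqR.
exists (equivalence_partition R setT); split=> // [|x y]; last first.
  rewrite -[RHS]negbK; have [/eqP covP tI _] := and3P partP.
  by rewrite negbK eq_pblock ?covP ?inE // pblock_equivalence_partition ?inE // negbK.
have trT := transversalP partP.
rewrite -(card_transversal trT); apply: oG => //.
apply/cliqueP => x y xT yT; apply: contraNT => nxy; apply/eqP.
apply: (pblock_inj trT) => //.
have [/eqP covP tI _] := and3P partP.
by apply/eqP; rewrite eq_pblock ?covP ?inE // pblock_equivalence_partition ?inE.
Qed.

Lemma union_of_one_cliqueP (G : sgraph) : union_of_cliques 1 G <-> clique [set: G].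
Proof.
split=> [[P [partP leP eP]]|/cliqueP cG].
  have [/eqP covP _ _] := and3P partP.
  apply/cliqueP => x y _ _ xy; rewrite eP xy /=; apply/eqP.
  by apply: (card_le1_eqP leP); apply: pblock_mem; rewrite covP inE.
(* Blocks are nonempty, so the graph without vertices needs the empty partition and any other graph
   the one-block partition. *)
have [G0|/set0Pn[x0 _]] := eqVneq [set: G] set0.
  exists set0; rewrite cards0; split=> // [|x].
    by rewrite /partition /trivIset /cover !big_set0 G0 cards0 inE !eqxx.
  by have := in_setT x; rewrite G0 inE.
have tP : trivIset [set [set: G]] by rewrite /trivIset /cover !big_set1.
exists [set [set: G]]; rewrite cards1; split=> // [|x y].
  apply/and3P; split=> //; first by rewrite /cover big_set1.
  by rewrite inE; apply/eqP => /setP/(_ x0); rewrite !inE.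
have pE z : pblock [set [set: G]] z = setT.
  by apply: def_pblock tP _ _; rewrite inE.
rewrite !pE eqxx andbT; apply/idP/idP => [|xy]; last by apply: cG; rewrite ?inE.
by apply: contraTneq => ->; rewrite edge_irrefl.
Qed.

Lemma val_imsetT (G : sgraph) (S : {set G}) :
  sval @: [set: induced S] = S.
Proof.
apply/setP => x; apply/imsetP/idP => [[y _ ->]|xS]; first exact: (valP y).
by exists (exist _ x xS).
Qed.

Lemma polarP s (G : sgraph) : polar s 1 G <-> polar_set s [set: G].
Proof.
have cE (A : {set G}) : clique [set: induced A] = clique A.
  by rewrite -(@clique_imset G (induced A) sval) ?val_imsetT //; exact: val_inj.
have mE (A : {set G}) : multipartite [set: induced A] = multipartite A.
  by rewrite -(@multipartite_imset G (induced A) sval) ?val_imsetT //; exact: val_inj.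
have oE (A : {set G}) : omega [set: induced A] = omega A.
  by rewrite -(@omega_imset G (induced A) sval) ?val_imsetT //; exact: val_inj.
split=> [[A [/complete_multipartiteP[]]]|/polar_setP[A /and4P[_ mA oA cB]]].
  rewrite mE oE => mA oA /union_of_one_cliqueP; rewrite cE => cB.
  by apply/polar_setP; exists A; rewrite /polar_witness subsetT mA oA setTD cB.
exists A; split; first by apply/complete_multipartiteP; rewrite mE oE.
by apply/union_of_one_cliqueP; rewrite cE -setTD.
Qed.

Lemma polar_inducedP s (G : sgraph) (S : {set G}) :
  polar s 1 (induced S) <-> polar_set s S.
Proof.
have -> : polar_set s S = polar_set s [set: induced S].
  by rewrite -(@polar_set_imset G (induced S) sval) ?val_imsetT //; exact: val_inj.
exact: polarP.
Qed.

(** Polarity is hereditary, so deleting single vertices suffices to test minimality. Being a cograph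
    is kept apart, so no listed graph has to be checked for an induced [P_4]. *)
Definition critical s (G : sgraph) :=
  ~~ polar_set s [set: G] /\ forall x : G, polar_set s (setT :\ x).

Lemma minimal_polar_obstructionP s (G : sgraph) :
  minimal_polar_obstruction s 1 G <-> cograph G /\ critical s G.
Proof.
split=> [[cG npG minG]|[cG [npG minG]]].
  split=> //; split=> [|x]; first by apply/negP => /polarP.
  apply/polar_inducedP; apply: minG; rewrite properE subsetT /=.
  by apply/subsetPn; exists x; rewrite !inE ?eqxx.
split=> // [/polarP|S]; first exact/negP.
rewrite properE subsetT /= => /subsetPn[x _ xS].
apply/polar_inducedP; apply: polar_setS (minG x).
by apply/subsetP => y yS; rewrite !inE andbT; apply: contraNneq xS => <-.
Qed.

Lemma contains_polar s (G H : sgraph) : contains_induced G H ->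
  polar_set s [set: G] -> polar_set s [set: H].
Proof.
case=> f [f_inj f_edge]; rewrite -(polar_set_imset f_inj f_edge).
by apply: polar_setS; exact: subsetT.
Qed.

Lemma contains_nonpolar_small s (G H : sgraph) : contains_induced G H ->
  ~~ polar_set s [set: H] -> #|H| < #|G| ->
  exists x : G, ~~ polar_set s (setT :\ x).
Proof.
case=> f [f_inj f_edge] npH ltHG.
have /subsetPn[x _ xH] : ~~ ([set: G] \subset f @: [set: H]).
  apply: contraL ltHG => /subset_leq_card.
  by rewrite card_imset // !cardsT -leqNgt.
exists x; apply: contra npH; rewrite -(polar_set_imset f_inj f_edge).
apply: polar_setS; apply/subsetP => y yH; rewrite !inE andbT.
by apply: contraNneq xH => <-.
Qed.

(** If the copy of [H] missed a vertex of [G], deleting that vertex would leave a non-polar graph.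
    So the embedding is onto. *)
Lemma critical_isomorphic s (G H : sgraph) : critical s G ->
  contains_induced G H -> ~~ polar_set s [set: H] -> isomorphic G H.
Proof.
move=> [npG minG] GH npH.
have le_card : #|G| <= #|H|.
  rewrite leqNgt; apply/negP => /(contains_nonpolar_small GH npH)[x].
  by rewrite minG.
have [f [f_inj f_edge]] := GH; have [g fK gK] := inj_card_bij f_inj le_card.
exists g; split; first by exists f.
by move=> x y; rewrite -f_edge !gK.
Qed.

Lemma isomorphic_sym (G H : sgraph) : isomorphic G H -> isomorphic H G.
Proof.
move=> [f [[g fK gK] f_edge]]; exists g; split; first by exists f.
by move=> x y; rewrite -f_edge !gK.
Qed.

Lemma isomorphic_contains (G H : sgraph) : isomorphic G H -> contains_induced H G.
Proof. by move=> [f [/bij_inj f_inj f_edge]]; exists f. Qed.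

Lemma isomorphic_critical s (G H : sgraph) :
  isomorphic G H -> critical s H -> critical s G.
Proof.
move=> GH [npH minH]; split.
  by apply: contra npH; apply: contains_polar (isomorphic_contains (isomorphic_sym GH)).
move=> x; have [f [f_bij f_edge]] := GH; have f_inj := bij_inj f_bij.
rewrite -(polar_set_imset f_inj f_edge); apply: polar_setS (minH (f x)).
apply/subsetP => y' /imsetP[y yx ->]; move: yx; rewrite !inE.
by rewrite !andbT (inj_eq f_inj).
Qed.

(** * Cuts in P4-free graphs *)

(** Distinctness of the four vertices is not demanded: no two vertices of [P_4] have the same
    neighbours, so the pattern of edges forces it. *)
Definition P4_free (G : sgraph) := forall a b c d : G,
  a -- b -> b -- c -> c -- d -> ~~ (a -- c) -> ~~ (b -- d) -> ~~ (a -- d) -> False.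

Lemma edge_neq (G : sgraph) (x y : G) : x -- y -> x != y.
Proof. by apply: contraTneq => ->; rewrite edge_irrefl. Qed.

Lemma cograph_P4_free (G : sgraph) : cograph G -> P4_free G.
Proof.
move=> cG a b c d ab bc cd /negPf ac /negPf bd /negPf ad; apply: cG.
pose f (i : 'I_4) := nth a [:: a; b; c; d] i.
have f_edge (i j : path_graph 4) : (f i -- f j) = path_rel i j.
  move: i j => [[|[|[|[|i]]]] Hi] [[|[|[|[|j]]]] Hj] //; by rewrite /f /path_rel /= ?edge_irrefl //
    ?(edge_sym c a) ?(edge_sym d b) ?(edge_sym d a) ?(edge_sym b a)
    ?(edge_sym c b) ?(edge_sym d c) ?ab ?bc ?cd ?ac ?bd ?ad.
exists f; split=> // i j fij; apply/eqP.
have nij k : path_rel i k = path_rel j k by rewrite -!f_edge fij.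
move: (nij ord0) (nij (inord 1)) (nij (inord 2)) (nij (inord 3)).
rewrite /= /path_rel !inordK //.
by clear fij nij; move: i j => [[|[|[|[|i]]]] Hi] [[|[|[|[|j]]]] Hj].
Qed.

Lemma complementE (G : sgraph) (x y : G) :
  @edge (complement G) x y = (x != y) && ~~ (x -- y).
Proof. by []. Qed.

(** [P_4] is self-complementary: an induced path [a b c d] of the complement is the induced path
    [b d a c] of [G]. *)
Lemma complement_P4_free (G : sgraph) : P4_free G -> P4_free (complement G).
Proof.
move=> P4G a b c d /andP[nab ab] /andP[nbc bc] /andP[ncd cd].
rewrite !complementE !negb_and !negbK => ac bd ad.
have {}ac : @edge G a c.
  by case/orP: ac => // /eqP acE; move: ad; rewrite acE (negPf ncd) (negPf cd).
have {}bd : @edge G b d.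
  case/orP: bd => // /eqP bdE.
  by move: ad; rewrite -bdE (negPf nab) (negPf ab).
have {}ad : @edge G a d.
  by case/orP: ad => // /eqP adE; rewrite adE edge_sym (negPf cd) in ac.
apply: (P4G b d a c) => //; rewrite edge_sym //.
Qed.

(** The value [false] stands for a disjoint union and [true] for a join; complementation exchanges
    them. Working relative to [S] keeps inductions inside one graph. *)
Definition cut (G : sgraph) (b : bool) (S X : {set G}) :=
  [/\ X \subset S, X != set0, S :\: X != set0
    & forall x y, x \in X -> y \in S :\: X -> (x -- y) = b].

Lemma cut_complement (G : sgraph) b (S X : {set G}) :
  @cut (complement G) b S X <-> cut (~~ b) S X.
Proof.
split=> -[sXS X0 SX0 eX]; split=> // x y xX yX.
  have := eX x y xX yX; rewrite complementE => <-.
  have -> : x != y by apply: contraTneq xX => ->; case/setDP: yX.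
  by rewrite negbK.
rewrite complementE (eX x y xX yX).
have -> : x != y by apply: contraTneq xX => ->; case/setDP: yX.
by rewrite negbK.
Qed.

(** If [v] is adjacent to all of [S], then [v] alone is one side of a join. Otherwise let [X] be a
    side with a non-neighbour of [v]. If [v] has no neighbour on the other side, that side splits
    off. If it has a neighbour [y] there, the non-neighbours of [v] in [X] split off: an edge from
    such a [z] to a neighbour [w] of [v] in [X] would give the induced path [z w v y]. *)
Lemma cut_false_setU1 (G : sgraph) (S X : {set G}) v : P4_free G ->
  v \notin S -> cut false S X -> exists b Y, cut b (v |: S) Y.
Proof.
move=> P4G vS; wlog /exists_inP[x xX vx] :
    X / [exists x in X, ~~ (v -- x)].
  move=> IH cX; have [|] := boolP [exists x in X, ~~ (v -- x)].
    by move=> h; exact: IH h cX.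
  rewrite negb_exists_in => /forall_inP vX.
  have [sXS X0 SX0 eX] := cX.
  have cY : cut false S (S :\: X).
    split=> //; first exact: subsetDl.
      by rewrite setDDr setDv set0U (setIidPr sXS).
    move=> x y xS; rewrite setDDr setDv set0U => /setIP[_ yX].
    by rewrite edge_sym eX.
  have [|] := boolP [exists x in S :\: X, ~~ (v -- x)].
    by move=> h; exact: IH h cY.
  rewrite negb_exists_in => /forall_inP vY.
  exists true, [set v]; split.
  - by rewrite sub1set !inE eqxx.
  - by apply/set0Pn; exists v; rewrite inE.
  - case/set0Pn: X0 => x xX; apply/set0Pn; exists x; rewrite !inE.
    rewrite (subsetP sXS _ xX) orbT andbT.
    by apply: contraNneq vS => <-; exact: (subsetP sXS).
  move=> x y /set1P->; rewrite !inE => /andP[yv].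
  rewrite (negPf yv) /= => yS; have [yX|yX] := boolP (y \in X).
    by have := vX y yX; rewrite negbK.
  by have := vY y; rewrite inE yX yS negbK; exact.
move=> [sXS X0 SX0 eX].
have [/exists_inP[y yY vy]|] := boolP [exists y in S :\: X, v -- y]; last first.
  rewrite negb_exists_in => /forall_inP vY.
  exists false, (S :\: X); split=> //.
  - by apply: subset_trans (subsetDl _ _) (subsetUr _ _).
  - apply/set0Pn; exists v; rewrite !inE eqxx /= (negPf vS) andbF.
    by [].
  move=> y z yY; rewrite !inE => /andP[nz /orP[/eqP->|zS]].
    by rewrite edge_sym; apply: negbTE; exact: vY.
  move: nz; rewrite zS andbT negbK => zX.
  by rewrite edge_sym; exact: eX.
exists false, [set z in X | ~~ (v -- z)]; split.
- apply/subsetP => z; rewrite !inE => /andP[/(subsetP sXS)-> _].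
  by rewrite orbT.
- by apply/set0Pn; exists x; rewrite inE xX.
- apply/set0Pn; exists v; rewrite !inE eqxx edge_irrefl /= !andbT.
  by apply: contra vS; exact: (subsetP sXS).
move=> z w; rewrite inE => /andP[zX vz].
rewrite !inE negb_and negbK => /andP[nw /orP[/eqP->|wS]].
  by rewrite edge_sym; exact: negbTE.
have [wX|wX] := boolP (w \in X); last by apply: eX; rewrite // inE wX.
move: nw; rewrite wX /= => vw; apply/negP => zw.
apply: (P4G z w v y) => //; first by rewrite edge_sym.
- by rewrite edge_sym.
- by rewrite eX.
- by rewrite eX.
Qed.

Lemma cut_exists (G : sgraph) (S : {set G}) :
  P4_free G -> 1 < #|S| -> exists b X, cut b S X.
Proof.
move=> P4G; move: {2}#|S| (leqnn #|S|) => n; elim: n S => [|n IHn] S leSn ltS.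
  by lia.
have [v vS] : exists v, v \in S by apply/set0Pn; rewrite -card_gt0; lia.
have := cardsD1 v S; rewrite vS => cS.
rewrite -(setD1K vS); set S' := S :\ v in cS *.
have vS' : v \notin S' by rewrite !inE eqxx.
have [lt1|le1] := ltnP 1 #|S'|; last first.
  have /eqP/cards1P[w wE] : #|S'| = 1 by lia.
  have wv : w != v by move: vS'; rewrite wE inE eq_sym.
  exists (v -- w), [set v]; split.
  - exact: subsetUl.
  - by apply/set0Pn; exists v; rewrite inE.
  - by apply/set0Pn; exists w; rewrite wE !inE eqxx orbT wv.
  move=> x y /set1P->; rewrite wE !inE => /andP[/negPf->] /=.
  by move/eqP->.
have leS' : #|S'| <= n by lia.
have [b [X cX]] := IHn S' leS' lt1.
(* A join is a disjoint union in the complement, which is P4-free too, so the same extension lemma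
   serves both cases. *)
case: b cX => cX.
  have /cut_complement cX' : cut (~~ false) S' X by [].
  have [b [Y cY]] := cut_false_setU1 (complement_P4_free P4G) vS' cX'.
  by exists (~~ b), Y; exact/cut_complement.
exact: cut_false_setU1 cX.
Qed.

Lemma cutC (G : sgraph) b (S X : {set G}) : cut b S X -> cut b S (S :\: X).
Proof.
move=> [sXS X0 SX0 eX].
have SSX : S :\: (S :\: X) = X by rewrite setDDr setDv set0U (setIidPr sXS).
split; rewrite ?SSX //; first exact: subsetDl.
by move=> x y xX yX; rewrite edge_sym eX.
Qed.

(** This is induction along the cotree. *)
Lemma cut_ind (G : sgraph) (P : {set G} -> Prop) : P4_free G ->
  (forall S : {set G}, #|S| <= 1 -> P S) ->
  (forall b (S X : {set G}), cut b S X -> P X -> P (S :\: X) -> P S) ->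
  forall S, P S.
Proof.
move=> P4G P1 Pcut S; move: {2}#|S| (leqnn #|S|) => n.
elim: n S => [|n IHn] S leSn; first by apply: P1; lia.
have [le1|lt1] := leqP #|S| 1; first exact: P1.
have [b [X cX]] := cut_exists P4G lt1.
have [sXS X0 SX0 _] := cX.
have := cardsID X S; rewrite (setIidPr sXS) => cS.
move: X0 SX0; rewrite -!card_gt0 => X0 SX0.
by apply: Pcut cX _ _; apply: IHn; lia.
Qed.

(** * Split sets, [2K_2] and [C_4] *)

Section Quadruples.
Variable G : sgraph.
Implicit Types (a b c d : G) (A S X Y : {set G}).

(** In these patterns the edges force distinctness, except for opposite vertices of a [C_4]: they
    have the same neighbours and must be declared distinct. *)
Definition is_2K2 a b c d :=
  [/\ a -- b, c -- d
    & [/\ ~~ (a -- c), ~~ (a -- d), ~~ (b -- c) & ~~ (b -- d)]].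

Definition is_C4 a b c d :=
  [/\ a != c, b != d, ~~ (a -- c), ~~ (b -- d)
    & [/\ a -- b, b -- c, c -- d & d -- a]].

Definition is_coP3 a b c := [/\ a -- c, ~~ (a -- b) & ~~ (b -- c)].

Definition is_split S := exists A,
  [/\ A \subset S, {in A &, forall x y, (x -- y) = false} & clique (S :\: A)].

Lemma split_2K2 S a b c d : a \in S -> b \in S -> c \in S -> d \in S ->
  is_2K2 a b c d -> ~ is_split S.
Proof.
move=> aS bS cS dS [ab cd [ac ad bc bd]] [A [sAS iA /cliqueP cA]].
have side x y : x \in S -> y \in S -> x -- y ->
    exists2 z, z \in S :\: A & (z == x) || (z == y).
  move=> xS yS xy; have [xA|xA] := boolP (x \in A); last first.
    by exists x; rewrite ?eqxx // inE xA.
  exists y; rewrite ?eqxx ?orbT // inE yS andbT.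
  by apply/negP => yA; rewrite iA in xy.
have [z zS zE] := side _ _ aS bS ab; have [w wS wE] := side _ _ cS dS cd.
have : ~~ (z -- w) by case/orP: zE => /eqP->; case/orP: wE => /eqP->.
have nzw : z != w.
  apply/eqP => zw; subst w.
  case/orP: zE => /eqP zE; case/orP: wE => /eqP wE; subst z; subst.
  - by rewrite cd in ad.
  - by rewrite edge_sym cd in ac.
  - by rewrite cd in bd.
  - by rewrite edge_sym cd in bc.
by rewrite cA.
Qed.

Lemma split_C4 S a b c d : a \in S -> b \in S -> c \in S -> d \in S ->
  is_C4 a b c d -> ~ is_split S.
Proof.
move=> aS bS cS dS [ac bd nac nbd [ab bc cd da]] [A [sAS iA /cliqueP cA]].
have side x y : x \in S -> y \in S -> x != y -> ~~ (x -- y) ->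
    exists2 z, z \in A & (z == x) || (z == y).
  move=> xS yS nxy; have [xA|xA] := boolP (x \in A); first by exists x; rewrite ?eqxx.
  have [yA|yA] := boolP (y \in A); first by exists y; rewrite ?eqxx ?orbT.
  by rewrite cA // inE ?xA ?yA.
have [z zA zE] := side _ _ aS cS ac nac; have [w wA wE] := side _ _ bS dS bd nbd.
have : z -- w.
  by case/orP: zE => /eqP->; case/orP: wE => /eqP->; rewrite // edge_sym.
by rewrite iA.
Qed.

Lemma polar_split s S : 0 < s -> is_split S -> polar_set s S.
Proof.
move=> s_gt0 [A [sAS iA cB]]; apply/polar_setP; exists A; apply/and4P; split=> //.
  by apply/multipartiteP => x y z xA yA zA; rewrite !iA.
apply/omega_leP => K /subsetP sKA /cliqueP cK; apply: leq_trans s_gt0.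
apply/card_le1_eqP => x y xK yK; apply/eqP; apply: contraTT isT => nxy.
have xA := sKA _ xK; have yA := sKA _ yK.
by have := cK _ _ xK yK; rewrite eq_sym nxy iA // => /(_ isT).
Qed.

Lemma edgeless_or_edge X :
  {in X &, forall x y, (x -- y) = false} \/ exists x y, [/\ x \in X, y \in X & x -- y].
Proof.
have [/exists_inP[x xX /exists_inP[y yX xy]]|] :=
  boolP [exists x in X, exists y in X, x -- y]; first by right; exists x, y.
rewrite negb_exists_in => /forall_inP nX; left => x y xX yX.
by have := nX x xX; rewrite negb_exists_in => /forall_inP/(_ y yX)/negPf.
Qed.

Lemma cut_false_notin X S a b : cut false S X -> a -- b -> b \in S ->
  a \in X -> b \in X.
Proof.
move=> [_ _ _ eX] ab bS aX; apply: contraTT ab => bX.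
by rewrite eX // inE bX.
Qed.

(** The forbidden-subgraph theorem for split graphs, where [C_5] does not occur because it contains
    [P_4]. A join of two split sets is split when one side is a clique; otherwise a non-edge on each
    side gives a [C_4]. Dually, a disjoint union is split when one side is edgeless, and otherwise
    contains [2K_2]. *)
Lemma split_or_obstruction (P4G : P4_free G) S :
  is_split S \/ exists a b c d,
    [/\ a \in S, b \in S, c \in S & d \in S] /\ (is_2K2 a b c d \/ is_C4 a b c d).
Proof.
move: S; apply: (cut_ind P4G) => [S le1|b S X cX IHX IHY].
  left; exists set0; split; rewrite ?sub0set ?setD0 //; first by move=> x y; rewrite inE.
  by apply/cliqueP => x y xS yS /eqP[]; exact: (card_le1_eqP le1).
set Y := S :\: X in IHY *; have [sXS X0 Y0 eX] := cX.
have sYS : Y \subset S by exact: subsetDl.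
have lift (Z : {set G}) : Z \subset S -> (exists a b c d,
    [/\ a \in Z, b \in Z, c \in Z & d \in Z] /\ (is_2K2 a b c d \/ is_C4 a b c d)) ->
  exists a b c d,
    [/\ a \in S, b \in S, c \in S & d \in S] /\ (is_2K2 a b c d \/ is_C4 a b c d).
  move=> /subsetP sZ [x [y [z [w [[xZ yZ zZ wZ] h]]]]]; exists x, y, z, w.
  by split=> //; split; exact: sZ.
case: IHX => [sX|h]; last by right; exact: lift sXS h.
case: IHY => [sY|h]; last by right; exact: lift sYS h.
have XYS : X :|: Y = S by rewrite -(setID S X) (setIidPr sXS).
have [A [sAX iA cA]] := sX; have [B [sBY iB cB]] := sY.
case: b cX eX => cX eX.
  have [cX'|/noncliqueP[a [c [aX cX' nac ac]]]] := boolP (clique X).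
    left; exists B; split=> //; first exact: subset_trans sBY sYS.
    apply/cliqueP => x y; rewrite -XYS => /setDP[/setUP[xX|xY] xB] /setDP[/setUP[yX|yY] yB] xy.
    - by move/cliqueP: cX'; exact.
    - exact: eX.
    - by rewrite edge_sym eX.
    by move/cliqueP: cB; apply; rewrite // inE ?xB ?yB.
  have [cY'|/noncliqueP[u [w [uY wY nuw uw]]]] := boolP (clique Y).
    left; exists A; split=> //; first exact: subset_trans sAX sXS.
    apply/cliqueP => x y; rewrite -XYS => /setDP[/setUP[xX|xY] xA] /setDP[/setUP[yX|yY] yA] xy.
    - by move/cliqueP: cA; apply; rewrite // inE ?xA ?yA.
    - exact: eX.
    - by rewrite edge_sym eX.
    by move/cliqueP: cY'; exact.
  right; exists a, u, c, w; split; first by split; (exact: (subsetP sXS) || exact: (subsetP sYS)).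
  right; split=> //; split; (exact: eX || (rewrite edge_sym; exact: eX)).
have [iX|[a [c [aX cX' ac]]]] := edgeless_or_edge X.
  left; exists (X :|: B); split; first by rewrite subUset sXS (subset_trans sBY sYS).
    move=> x y /setUP[xX|xB] /setUP[yX|yB].
    - exact: iX.
    - by apply: eX => //; exact: (subsetP sBY).
    - by rewrite edge_sym; apply: eX => //; exact: (subsetP sBY).
    exact: iB.
  by rewrite -setDDl.
have [iY|[u [w [uY wY uw]]]] := edgeless_or_edge Y.
  left; exists (Y :|: A); split; first by rewrite subUset sYS (subset_trans sAX sXS).
    move=> x y /setUP[xX|xB] /setUP[yX|yB].
    - exact: iY.
    - by rewrite edge_sym; apply: eX => //; exact: (subsetP sAX).
    - by apply: eX => //; exact: (subsetP sAX).
    exact: iA.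
  by rewrite -setDDl /Y setDDr setDv set0U (setIidPr sXS).
right; exists a, c, u, w; split; first by split; (exact: (subsetP sXS) || exact: (subsetP sYS)).
by left; split=> //; split; rewrite eX.
Qed.

End Quadruples.

(** * Containment of the listed graphs *)

Section C4coP3.
Variable G : sgraph.
Implicit Type S : {set G}.

Definition has_C4 S := exists a b c d,
  [/\ a \in S, b \in S, c \in S & d \in S] /\ is_C4 a b c d.

Definition has_C4_plus_K1 S := exists a b c d v,
  [/\ a \in S, b \in S, c \in S & d \in S] /\
  [/\ is_C4 a b c d, v \in S
    & [/\ ~~ (v -- a), ~~ (v -- b), ~~ (v -- c) & ~~ (v -- d)]].

Definition has_coP3_join_co_K2 S := exists a b c d d',
  [/\ a \in S, b \in S, c \in S, d \in S & d' \in S] /\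
  [/\ is_coP3 a b c, d != d', ~~ (d -- d')
    & forall x, x \in [:: a; b; c] -> x -- d /\ x -- d'].

(** Across a disjoint union the [C_4] lies on one side, and any vertex of the other side is isolated
    from it. Across a join the co-P3 lies on one side, since non-adjacent vertices are never
    separated. If the other side has a non-edge, it completes the second pattern; if it is a clique,
    the [C_4] too lies on the side of the co-P3, and induction applies. *)
Lemma C4_nonmultipartite S : P4_free G -> has_C4 S -> ~~ multipartite S ->
  has_C4_plus_K1 S \/ has_coP3_join_co_K2 S.
Proof.
move=> P4G; move: S; apply: (cut_ind P4G) => [S le1|b S X cX].
  move=> [a [b [c [d [[aS _ cS _] [/eqP ac]]]]]]; case: ac.
  exact: (card_le1_eqP le1).
pose goal S := has_C4_plus_K1 S \/ has_coP3_join_co_K2 S.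
move=> IHX IHY [a [c [a' [c' [[aS cS a'S c'S] C4]]]]] nmS.
have [aa' cc' naa' ncc' [ac ca' a'c' c'a]] := C4.
have lift (Z : {set G}) : Z \subset S -> goal Z -> goal S.
  move=> /subsetP sZ; case.
    move=> [x [y [z [w [v [[xZ yZ zZ wZ] [h vZ hv]]]]]]]; left.
    by exists x, y, z, w, v; split; split=> //; exact: sZ.
  move=> [x [y [z [w [v [[xZ yZ zZ wZ vZ] h]]]]]]; right.
  by exists x, y, z, w, v; split=> //; split; exact: sZ.
case: b cX => cX; last first.
  have step Z : cut false S Z -> a \in Z -> goal S.
    move=> cZ aZ; have [_ _ /set0Pn[v vZ] eZ] := cZ.
    have cZ' := cut_false_notin cZ ac cS aZ.
    have a'Z := cut_false_notin cZ ca' a'S cZ'.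
    have c'Z := cut_false_notin cZ a'c' c'S a'Z.
    left; exists a, c, a', c', v; split=> //; split=> //.
      by case/setDP: vZ.
    by split; rewrite edge_sym eZ.
  have [aX|aX] := boolP (a \in X); first exact: step cX aX.
  by apply: step (cutC cX) _; rewrite inE aX.
have [x [y [z [[xS yS zS] [xy yz xz]]]]] := nonmultipartiteP _ nmS.
have same Z u v : cut true S Z -> u \in Z -> v \in S -> ~~ (u -- v) -> v \in Z.
  move=> [_ _ _ eZ] uZ vS; apply: contraNT => vZ.
  by apply: eZ; rewrite // inE vZ.
have step Z : cut true S Z -> y \in Z ->
    (has_C4 Z -> ~~ multipartite Z -> goal Z) -> goal S.
  move=> cZ yZ IHZ; have [sZS _ _ eZ] := cZ.
  have yx : ~~ (y -- x) by rewrite edge_sym.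
  have xZ := same _ _ _ cZ yZ xS yx; have zZ := same _ _ _ cZ yZ zS yz.
  have [clY|/noncliqueP[d [d' [dZ d'Z dd' ndd']]]] := boolP (clique (S :\: Z)).
    apply: lift sZS _; apply: IHZ; last by apply/nonmultipartiteP; exists x, y, z.
    have inZ u v : u \in S -> v \in S -> u != v -> ~~ (u -- v) -> u \in Z.
      move=> uS vS uv nuv; apply: contraNT (nuv) => uZ.
      move/cliqueP: clY; apply=> //; rewrite inE ?uZ // vS andbT.
      apply: contra uZ => vZ; apply: (same _ _ _ cZ vZ uS).
      by rewrite edge_sym.
    exists a, c, a', c'; split=> //; split.
    - exact: inZ aS a'S aa' naa'.
    - exact: inZ cS c'S cc' ncc'.
    - by apply: inZ a'S aS _ _; rewrite 1?eq_sym // edge_sym.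
    - by apply: inZ c'S cS _ _; rewrite 1?eq_sym // edge_sym.
  have [dS _] := setDP dZ; have [d'S _] := setDP d'Z.
  right; exists x, y, z, d, d'; split=> //; split=> //.
  by move=> w; rewrite !inE => /or3P[] /eqP->; split; exact: eZ.
have [yX|yX] := boolP (y \in X); first exact: step cX yX IHX.
by apply: step (cutC cX) _ IHY; rewrite inE yX.
Qed.

End C4coP3.

(** * Embeddings of the small graphs *)

Section Containment.
Variable G : sgraph.
Implicit Types (a b c d : G) (K X Y : {set G}).

(** Confining the image to [X] lets embeddings into two sets be combined when all or none of the
    edges between the sets are present. *)
Definition sits_in (H : sgraph) X := exists f : H -> G,
  [/\ injective f, forall x, f x \in X & forall x y, (f x -- f y) = (x -- y)].

Lemma sits_inS H X Y : X \subset Y -> sits_in H X -> sits_in H Y.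
Proof.
move=> /subsetP sXY [f [f_inj fX f_edge]]; exists f; split=> // x; exact: sXY.
Qed.

Lemma sits_in_contains H X : sits_in H X -> contains_induced G H.
Proof. by move=> [f [f_inj _ f_edge]]; exists f. Qed.

Lemma sits_in_complete n K X :
  clique K -> n <= #|K| -> K \subset X -> sits_in (complete n) X.
Proof.
move=> /cliqueP cK le_nK /subsetP sKX.
pose f (i : 'I_n) := enum_val (widen_ord le_nK i).
have f_inj : injective f.
  by move=> i j /enum_val_inj/(congr1 val) /= ij; exact: val_inj.
exists f; split=> // [i|i j]; first by apply: sKX; exact: enum_valP.
have [->|ij] := eqVneq i j; first by rewrite !edge_irrefl.
rewrite /edge /= -/(edge (f i) (f j)) /complete_rel ij.
by apply: cK; rewrite ?enum_valP // (inj_eq f_inj).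
Qed.

Lemma sits_in_K1 a X : a \in X -> sits_in (complete 1) X.
Proof.
move=> aX; apply: (@sits_in_complete _ [set a]); rewrite ?cards1 ?sub1set //.
by apply/cliqueP => x y /set1P-> /set1P->; rewrite eqxx.
Qed.

Lemma sits_in_K2 a b X : a -- b -> a \in X -> b \in X -> sits_in (complete 2) X.
Proof.
move=> ab aX bX; apply: (@sits_in_complete _ [set a; b]).
- apply/cliqueP => x y /set2P[] -> /set2P[] ->; rewrite ?eqxx // => _.
  by rewrite edge_sym.
- by rewrite cards2 edge_neq.
- by apply/subsetP => x /set2P[] ->.
Qed.

Lemma sits_in_co_K2 a b X : a != b -> ~~ (a -- b) -> a \in X -> b \in X ->
  sits_in (complement (complete 2)) X.
Proof.
move=> nab /negPf ab aX bX; exists (fun i : 'I_2 => if i == ord0 then a else b).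
split=> [i j|i|i j].
- case: (unliftP ord0 i) => [i'|] ->; case: (unliftP ord0 j) => [j'|] ->;
    rewrite ?eqxx ?(negPf (neq_lift _ _)) // ?(ord1 i') ?(ord1 j') //
      eq_sym ?(negPf (neq_lift _ _)).
  + by move=> /eqP; rewrite eq_sym (negPf nab).
  + by move=> /eqP; rewrite (negPf nab).
- by case: eqP.
have -> : @edge (complement (complete 2)) i j = false.
  by rewrite complementE /edge /= /complete_rel; case: eqP.
by case: ifP; case: ifP; rewrite ?edge_irrefl // edge_sym.
Qed.

Lemma sits_in_coP3 a b c X : is_coP3 a b c -> a \in X -> b \in X -> c \in X ->
  sits_in (complement (path_graph 3)) X.
Proof.
move=> [ac /negPf ab /negPf bc] aX bX cX.
have nac := edge_neq ac.
have nab : a != b by apply: contraTneq ac => ->; rewrite bc.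
have nbc : b != c by apply: contraTneq ac => <-; rewrite ab.
exists (fun i : 'I_3 => nth a [:: a; b; c] i); split=> [i j|i|i j].
- move: i j => [[|[|[|i]]] Hi] [[|[|[|j]]] Hj] //= /eqP;
  by rewrite ?(negPf nab) ?(negPf nac) ?(negPf nbc) 1?eq_sym
    ?(negPf nab) ?(negPf nac) ?(negPf nbc) // => _; apply: val_inj.
- by move: i => [[|[|[|i]]] Hi].
rewrite complementE; move: i j => [[|[|[|i]]] Hi] [[|[|[|j]]] Hj] //;
by rewrite /edge /= -/(@edge G) ?edge_irrefl ?ac ?ab ?bc 1?edge_sym ?ac ?ab ?bc.
Qed.

Lemma sits_in_P3 a b c X : a -- b -> b -- c -> a != c -> ~~ (a -- c) ->
  a \in X -> b \in X -> c \in X -> sits_in (path_graph 3) X.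
Proof.
move=> ab bc nac /negPf ac aX bX cX.
have nab := edge_neq ab; have nbc := edge_neq bc.
exists (fun i : 'I_3 => nth a [:: a; b; c] i); split=> [i j|i|i j].
- move: i j => [[|[|[|i]]] Hi] [[|[|[|j]]] Hj] //= /eqP;
  by rewrite ?(negPf nab) ?(negPf nac) ?(negPf nbc) 1?eq_sym
    ?(negPf nab) ?(negPf nac) ?(negPf nbc) // => _; apply: val_inj.
- by move: i => [[|[|[|i]]] Hi].
move: i j => [[|[|[|i]]] Hi] [[|[|[|j]]] Hj] //;
by rewrite /edge /= -/(@edge G) ?edge_irrefl ?ac ?ab ?bc 1?edge_sym ?ac ?ab ?bc.
Qed.

Lemma sits_in_C4 a b c d X : is_C4 a b c d ->
  a \in X -> b \in X -> c \in X -> d \in X -> sits_in (cycle_graph 4) X.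
Proof.
move=> [nac nbd /negPf ac /negPf bd [ab bc cd da]] aX bX cX dX.
have nab := edge_neq ab; have nbc := edge_neq bc; have ncd := edge_neq cd.
have nda := edge_neq da.
exists (fun i : 'I_4 => nth a [:: a; b; c; d] i); split=> [i j|i|i j].
- move: i j => [[|[|[|[|i]]]] Hi] [[|[|[|[|j]]]] Hj] //= /eqP;
  by rewrite ?(negPf nab) ?(negPf nac) ?(negPf nbc) ?(negPf ncd) ?(negPf nda)
     ?(negPf nbd) 1?eq_sym
    ?(negPf nab) ?(negPf nac) ?(negPf nbc)  ?(negPf ncd) ?(negPf nda)
     ?(negPf nbd) // => _; apply: val_inj.
- by move: i => [[|[|[|[|i]]]] Hi].
move: i j => [[|[|[|[|i]]]] Hi] [[|[|[|[|j]]]] Hj] //;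
by rewrite /edge /= -/(@edge G) ?edge_irrefl ?ac ?ab ?bc ?bd ?cd ?da 1?edge_sym
  ?ac ?ab ?bc ?bd ?cd ?da.
Qed.

Lemma sits_in_disjoint_union H1 H2 X Y : sits_in H1 X -> sits_in H2 Y ->
  (forall x y, x \in X -> y \in Y -> (x != y) && ~~ (x -- y)) ->
  sits_in (disjoint_union H1 H2) (X :|: Y).
Proof.
move=> [f [f_inj fX f_edge]] [g [g_inj gY g_edge]] XY.
exists (fun u => match u with inl x => f x | inr y => g y end); split.
- move=> [x|x] [y|y].
  + by move/f_inj->.
  + by move=> fg; have := XY _ _ (fX x) (gY y); rewrite fg eqxx.
  + by move=> fg; have := XY _ _ (fX y) (gY x); rewrite fg eqxx.
  + by move/g_inj->.
- by move=> [x|x]; rewrite inE ?fX ?gY ?orbT.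
move=> [x|x] [y|y]; rewrite /= ?f_edge ?g_edge //.
  by have /andP[_ /negPf->] := XY _ _ (fX x) (gY y).
by rewrite edge_sym; have /andP[_ /negPf->] := XY _ _ (fX y) (gY x).
Qed.

Lemma sits_in_join H1 H2 X Y : sits_in H1 X -> sits_in H2 Y ->
  (forall x y, x \in X -> y \in Y -> x -- y) -> sits_in (join H1 H2) (X :|: Y).
Proof.
move=> [f [f_inj fX f_edge]] [g [g_inj gY g_edge]] XY.
exists (fun u => match u with inl x => f x | inr y => g y end); split.
- move=> [x|x] [y|y].
  + by move/f_inj->.
  + by move=> fg; have := XY _ _ (fX x) (gY y); rewrite fg edge_irrefl.
  + by move=> fg; have := XY _ _ (fX y) (gY x); rewrite fg edge_irrefl.
  + by move/g_inj->.
- by move=> [x|x]; rewrite inE ?fX ?gY ?orbT.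
move=> [x|x] [y|y]; rewrite /= ?f_edge ?g_edge //.
  by rewrite (XY _ _ (fX x) (gY y)).
by rewrite edge_sym (XY _ _ (fX y) (gY x)).
Qed.

Lemma sits_in_copies2 H X Y : sits_in H X -> sits_in H Y ->
  (forall x y, x \in X -> y \in Y -> (x != y) && ~~ (x -- y)) ->
  sits_in (copies 2 H) (X :|: Y).
Proof.
move=> [f [f_inj fX f_edge]] [g [g_inj gY g_edge]] XY.
exists (fun u : 'I_2 * H => if val u.1 == 0 then f u.2 else g u.2).
split=> [[[[|[|i]] Hi] x] [[[|[|j]] Hj] y] //=|[[[|[|i]] Hi] x] //=|
    [[[|[|i]] Hi] x] [[[|[|j]] Hj] y] //=].
- by move/f_inj->; congr (_, _); apply: val_inj.
- by move=> fg; have := XY _ _ (fX x) (gY y); rewrite fg eqxx.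
- by move=> fg; have := XY _ _ (fX y) (gY x); rewrite fg eqxx.
- by move/g_inj->; congr (_, _); apply: val_inj.
- by rewrite inE fX.
- by rewrite inE gY orbT.
- by have /andP[_ /negPf->] := XY _ _ (fX x) (gY y).
- by rewrite edge_sym; have /andP[_ /negPf->] := XY _ _ (fX y) (gY x).
Qed.

End Containment.

(** * Listed graphs inside disconnected non-polar graphs *)

Definition contains_essential (G : sgraph) :=
  exists2 H, essential H & contains_induced G H.

Definition disconnected_family s (H : sgraph) :=
  [\/ H = copies 2 (complete (s + 1)),
      H = disjoint_union (complete 2) (join (complement (complete 2)) (complete s))
    | H = disjoint_union (complete 1) (join (cycle_graph 4) (complete (s - 1)))].

Lemma isomorphic_refl (G : sgraph) : isomorphic G G.
Proof. by exists id; split=> //; exists id. Qed.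

Lemma isomorphic_trans (G H K : sgraph) :
  isomorphic G H -> isomorphic H K -> isomorphic G K.
Proof.
move=> [f [f_bij fE]] [g [g_bij gE]].
by exists (g \o f); split; [exact: bij_comp|move=> x y; rewrite /= gE fE].
Qed.

Lemma isomorphic_essential (G H : sgraph) :
  isomorphic G H -> essential H -> essential G.
Proof.
move=> GH; case=> /(isomorphic_trans GH);
  by [constructor 1|constructor 2|constructor 3|constructor 4].
Qed.

Section ContainedObstructions.
Variables (s : nat) (G : sgraph).
Hypothesis s_gt0 : 0 < s.
Implicit Types (K X Y : {set G}).

Let conclusion := contains_essential G \/
  exists2 H, disconnected_family s H & contains_induced G H.

Definition has_edge X := exists x y, [/\ x \in X, y \in X & x -- y].

Lemma cut_sits X : cut false setT X ->
  forall x y, x \in X -> y \in ~: X -> (x != y) && ~~ (x -- y).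
Proof.
move=> [_ _ _ eX] x y xX; rewrite inE => yX; rewrite eX ?inE ?yX // andbT.
by apply: contraNneq yX => <-.
Qed.

Lemma cut_setC X : cut false setT X -> cut false setT (~: X).
Proof. by rewrite -setTD; exact: cutC. Qed.

Lemma contains_K1_2K2 X a b c d v : cut false setT X ->
  a \in X -> b \in X -> c \in X -> d \in X -> v \in ~: X -> is_2K2 a b c d ->
  contains_essential G.
Proof.
move=> cX aX bX cX' dX vX [ab cd [ac ad bc bd]].
exists (disjoint_union (complete 1) (copies 2 (complete 2))).
  by constructor 1; exact: isomorphic_refl.
apply: (sits_in_contains (X := [set v] :|: ([set a; b] :|: [set c; d]))).
apply: sits_in_disjoint_union.
- by apply: (@sits_in_K1 _ v); rewrite inE.
- apply: sits_in_copies2.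
  + by apply: (sits_in_K2 ab); rewrite !inE eqxx ?orbT.
  + by apply: (sits_in_K2 cd); rewrite !inE eqxx ?orbT.
  have neq x y z : x -- y -> ~~ (y -- z) -> x != z.
    by move=> xy yz; apply: contraNneq yz => <-; rewrite edge_sym.
  move=> x y /set2P[]-> /set2P[]->; rewrite ?ac ?ad ?bc ?bd andbT.
  + exact: neq ab bc.
  + exact: neq ab bd.
  + by rewrite edge_sym in ab; exact: neq ab ac.
  + by rewrite edge_sym in ab; exact: neq ab ad.
move=> x y /set1P-> yX; rewrite eq_sym edge_sym.
by apply: (cut_sits cX) => //; case/setUP: yX => /set2P[] ->.
Qed.

(** The isolated vertex of a co-P3 in [X] serves as the [K_1]; its edge and an edge of the other
    side form the [2K_2]. *)
Lemma contains_K1_2K2_coP3 X : cut false setT X ->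
  ~~ multipartite X -> has_edge (~: X) -> contains_essential G.
Proof.
move=> cX /nonmultipartiteP[x [y [z [[xX yX zX] [xy yz xz]]]]] [u [v [uX vX uv]]].
exists (disjoint_union (complete 1) (copies 2 (complete 2))).
  by constructor 1; exact: isomorphic_refl.
apply: (sits_in_contains (X := [set y] :|: ([set x; z] :|: [set u; v]))).
have XX w t : w \in [set x; z] -> t \in [set u; v] -> (w != t) && ~~ (w -- t).
  move=> wE tE; apply: (cut_sits cX).
    by case/set2P: wE => ->.
  by case/set2P: tE => ->.
apply: sits_in_disjoint_union.
- by apply: (@sits_in_K1 _ y); rewrite inE.
- apply: sits_in_copies2 => //.
  + by apply: (sits_in_K2 xz); rewrite !inE eqxx ?orbT.
  + by apply: (sits_in_K2 uv); rewrite !inE eqxx ?orbT.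
move=> w t /set1P-> /setUP[/set2P[]->|tE].
- by rewrite edge_sym xy andbT; apply: contraNneq yz => ->.
- by rewrite yz andbT; apply: contraNneq xy => ->.
by apply: (cut_sits cX) => //; case/set2P: tE => ->.
Qed.

(** In a complete multipartite set two non-adjacent vertices have the same neighbours, and no vertex
    is non-adjacent to both ends of an edge. So a non-adjacent pair has a common neighbour. *)
Lemma multipartite_P3 X : multipartite X -> has_edge X -> ~~ clique X ->
  sits_in (path_graph 3) X.
Proof.
move=> /multipartiteP mX [a [b [aX bX ab]]] /noncliqueP[x [y [xX yX nxy xy]]].
have [w wX xw] : exists2 w, w \in X & x -- w.
  have [xa|xa] := boolP (x -- a); first by exists a.
  exists b => //; apply: contraLR ab => xb.
  by apply: (mX a x b) => //; rewrite edge_sym.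
apply: (@sits_in_P3 _ x w y) => //; apply: contraLR xw => wy.
by apply: (mX x y w) => //; rewrite edge_sym.
Qed.

Lemma clique_omega_le_card X : clique X -> multipartite X /\ omega X <= #|X|.
Proof.
move=> cX; have cE x y : x \in X -> y \in X -> (x -- y) = (x != y).
  move=> xX yX; have [->|] := eqVneq x y; first by rewrite edge_irrefl.
  by move/cliqueP: cX; exact.
split; last by apply/omega_leP => K /subset_leq_card.
apply/multipartiteP => x y z xX yX zX.
by rewrite !cE // !negbK => /eqP-> /eqP->.
Qed.

Lemma polar_cut X : multipartite X -> omega X <= s -> clique (~: X) ->
  polar_set s [set: G].
Proof.
move=> mX oX cX; apply/polar_setP; exists X.
by rewrite /polar_witness subsetT mX oX setTD.
Qed.

Lemma large_clique X : (omega X <= s) = false ->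
  exists K, [/\ K \subset X, clique K & s < #|K|].
Proof.
move=> oX; have [sK cK _] := max_cliqueP X; exists (max_clique X); split=> //.
by rewrite ltnNge -/(omega X) oX.
Qed.

(** Taking the two sides as classes fails only if [X] has a clique of size [s + 1]. This leads to
    [2K_{s+1}] if [X] is a clique, and to family (3) if [X] has a non-edge. *)
Lemma contains_clique_side X : cut false setT X -> ~~ polar_set s [set: G] ->
  multipartite X -> clique (~: X) -> has_edge (~: X) -> conclusion.
Proof.
move=> cX npG mX cY [u [v [uY vY uv]]].
have [oX|] := boolP (omega X <= s); first by rewrite (polar_cut mX) in npG.
move/negbTE/large_clique => [K [sKX cK ltK]].
right; have [cliqueX|/noncliqueP[a [a' [aX a'X naa' aa']]]] := boolP (clique X).
  have [mY oY] := clique_omega_le_card cY.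
  exists (copies 2 (complete (s + 1))); first by constructor 1.
  apply: sits_in_contains.
  apply: (@sits_in_copies2 _ _ X (~: X)); last exact: (cut_sits cX).
    by apply: (sits_in_complete cK); rewrite // addn1.
  (* Both sides are cliques, so the roles can be exchanged: a side with at most [s] vertices would
     serve as the multipartite class. *)
  apply: (sits_in_complete cY) => //; rewrite addn1 ltnNge.
  apply: contra npG => leY; apply: (polar_cut mY); first exact: leq_trans leY.
  by rewrite setCK.
exists (disjoint_union (complete 2) (join (complement (complete 2)) (complete s))).
  by constructor 2.
(* [a] and [a'] share a part, which contains at most one of the [s + 1] vertices of [K]; at least
   [s] remain, adjacent to both. *)
pose K' := [set x in K | x -- a].
have sK'X : K' \subset X.
  by apply: subset_trans sKX; apply/subsetP => x; rewrite inE => /andP[].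
apply: (sits_in_contains (X := ~: X :|: X)).
apply: sits_in_disjoint_union; first exact: (sits_in_K2 uv).
  apply: (@sits_inS _ _ ([set a; a'] :|: K')).
    rewrite subUset sK'X andbT; apply/subsetP => x /set2P[] -> //.
  apply: sits_in_join.
  - by apply: (sits_in_co_K2 naa' aa'); rewrite !inE eqxx ?orbT.
  - apply: (@sits_in_complete _ _ K') => //.
      by apply: subclique cK; apply/subsetP => x; rewrite inE => /andP[].
    by rewrite -ltnS; exact: leq_trans ltK (clique_meets_part mX sKX cK aX).
  move=> x y xE; rewrite inE => /andP[yK ya].
  have ay : a -- y by rewrite edge_sym.
  case/set2P: xE => -> //.
  move/multipartiteP: mX => mX; apply: contraLR ay => a'y.
  by apply: (mX a a' y) => //; exact: (subsetP sKX).
move=> x y xX yX; rewrite eq_sym edge_sym; exact: (cut_sits cX).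
Qed.

Lemma contains_two_edges X : cut false setT X -> ~~ polar_set s [set: G] ->
  has_edge X -> has_edge (~: X) -> conclusion.
Proof.
move=> cX npG edgeX edgeY; have cY := cut_setC cX.
have [mX|mX] := boolP (multipartite X); last first.
  by left; exact: contains_K1_2K2_coP3 cX mX edgeY.
have [mY|mY] := boolP (multipartite (~: X)); last first.
  by left; apply: contains_K1_2K2_coP3 cY mY _; rewrite setCK.
have [cliY|ncY] := boolP (clique (~: X)); first exact: contains_clique_side cX _ _ _ _.
have [cliX|ncX] := boolP (clique X).
  by apply: contains_clique_side cY npG mY _ _; rewrite setCK.
left; exists (copies 2 (path_graph 3)).
  by constructor 3; exact: isomorphic_refl.
apply: sits_in_contains; apply: sits_in_copies2 (cut_sits cX);
  exact: multipartite_P3.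
Qed.

Lemma contains_co_K2_C4 (a b c d v w : G) : is_C4 a b c d ->
  (forall x, x \in [:: a; b; c; d] -> ~~ (v -- x) && ~~ (w -- x)) ->
  v != w -> ~~ (v -- w) -> contains_essential G.
Proof.
move=> C4 nvw vw evw.
exists (disjoint_union (complement (complete 2)) (cycle_graph 4)).
  by constructor 2; exact: isomorphic_refl.
apply: (sits_in_contains (X := [set v; w] :|: [set x in [:: a; b; c; d]])).
apply: sits_in_disjoint_union.
- by apply: (sits_in_co_K2 vw evw); rewrite !inE eqxx ?orbT.
- by apply: (sits_in_C4 C4); rewrite !inE eqxx ?orbT.
have [_ _ _ _ [ab bc cd da]] := C4.
(* Every vertex of the cycle has a neighbour on it, whereas [v] and [w] have none; so they lie off
   the cycle. *)
have nbr x : x \in [:: a; b; c; d] -> exists2 y, y \in [:: a; b; c; d] & x -- y.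
  rewrite !inE => /or4P[]/eqP->.
  - by exists b; rewrite // !inE eqxx ?orbT.
  - by exists c; rewrite // !inE eqxx ?orbT.
  - by exists d; rewrite // !inE eqxx ?orbT.
  - by exists a; rewrite // !inE eqxx ?orbT.
move=> x y xvw; rewrite inE => yC; have [z zC yz] := nbr y yC.
have /andP[vy wy] := nvw y yC; have /andP[vz wz] := nvw z zC.
case/set2P: xvw => ->; rewrite ?vy ?wy andbT.
  by apply: contraNneq vz => ->.
by apply: contraNneq wz => ->.
Qed.

(** All edges lie in [X], and [G] is not split, so [X] contains [2K_2] or [C_4]. A [2K_2] and a
    vertex outside [X] form an essential graph, and so do a [C_4] and two vertices outside. If only
    one vertex is outside, [X] itself must fail as multipartite class, by a co-P3 or by a large
    clique. *)
Lemma contains_edgeless_side X : P4_free G -> cut false setT X ->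
  ~~ polar_set s [set: G] -> {in ~: X &, forall x y, (x -- y) = false} ->
  conclusion.
Proof.
move=> P4G cX npG iY; have cY := cut_setC cX; have eX := cut_sits cX.
have inX x y : x -- y -> x \in X.
  move=> xy; apply: contraLR (xy) => xX.
  have xY : x \in ~: X by rewrite inE.
  by rewrite iY //; apply: (cut_false_notin cY xy); rewrite ?inE.
have /set0Pn[v vY] : ~: X != set0 by have [_ ? _ _] := cY.
have [sG|] := split_or_obstruction P4G setT.
  by rewrite polar_split in npG.
move=> [a [b [c [d [_ [H2K2|C4]]]]]].
  left; have [ab cd _] := H2K2; apply: contains_K1_2K2 cX _ _ _ _ vY H2K2.
  - exact: inX ab.
  - by rewrite edge_sym in ab; exact: inX ab.
  - exact: inX cd.
  - by rewrite edge_sym in cd; exact: inX cd.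
have [_ _ _ _ [ab bc cd da]] := C4.
have aX := inX _ _ ab; have bX := inX _ _ bc.
have cX' := inX _ _ cd; have dX := inX _ _ da.
have C4X x : x \in [:: a; b; c; d] -> x \in X by rewrite !inE => /or4P[]/eqP->.
have nvX x y : x \in ~: X -> y \in X -> ~~ (x -- y).
  by move=> xY yX; rewrite edge_sym; have /andP[] := eX y x yX xY.
have [cliY|/noncliqueP[w [t [wY tY nwt ewt]]]] := boolP (clique (~: X)); last first.
  left; apply: (contains_co_K2_C4 C4 _ nwt ewt) => x /C4X xX.
  by rewrite !nvX.
have [mX|nmX] := boolP (multipartite X); last first.
  left; have C4S : has_C4 X by exists a, b, c, d.
  have [|] := C4_nonmultipartite P4G C4S nmX.
    move=> [a' [b' [c' [d' [w [[a'X b'X c'X d'X] [C4' wX [wa wb wc wd]]]]]]]].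
    have /andP[nwv ewv] := eX w v wX vY.
    apply: (contains_co_K2_C4 C4' _ nwv ewv) => x.
    by rewrite !inE => /or4P[]/eqP->; rewrite ?wa ?wb ?wc ?wd nvX.
  move=> [x [y [z [t [t' [[xX yX zX tX t'X] [coP3 ntt ett et]]]]]]].
  exists (disjoint_union (complete 1)
           (join (complement (path_graph 3)) (complement (complete 2)))).
    by constructor 4; exact: isomorphic_refl.
  apply: (sits_in_contains (X := ~: X :|: X)).
  apply: sits_in_disjoint_union; first exact: sits_in_K1 vY.
    apply: (@sits_inS _ _ ([set u in [:: x; y; z]] :|: [set t; t'])).
      rewrite subUset; apply/andP; split; apply/subsetP => u; rewrite !inE.
        by case/or3P => /eqP->.
      by case/orP => /eqP->.
    apply: sits_in_join.
    - by apply: (sits_in_coP3 coP3); rewrite !inE eqxx ?orbT.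
    - by apply: (sits_in_co_K2 ntt ett); rewrite !inE eqxx ?orbT.
    by move=> u w; rewrite inE => /et[ut ut'] /set2P[]->.
  by move=> u w uY wX; rewrite eq_sym edge_sym eX.
have [oX|] := boolP (omega X <= s); first by rewrite (polar_cut mX) in npG.
move/negbTE/large_clique => [K [sKX cK ltK]].
right; exists (disjoint_union (complete 1) (join (cycle_graph 4) (complete (s - 1)))).
  by constructor 3.
(* The cycle occupies two parts, that of [a] and [c] and that of [b] and [d]. Each costs [K] at most
   one of its [s + 1] vertices, leaving the [K_{s-1}] of family (4). *)
pose Ka := [set x in K | x -- a]; pose Kb := [set x in Ka | x -- b].
have sKaK : Ka \subset K by apply/subsetP => x; rewrite inE => /andP[].
have sKbKa : Kb \subset Ka by apply/subsetP => x; rewrite inE => /andP[].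
have sKaX := subset_trans sKaK sKX; have sKbX := subset_trans sKbKa sKaX.
have cKa := subclique sKaK cK; have cKb := subclique sKbKa cKa.
have := clique_meets_part mX sKX cK aX; rewrite -/Ka => leKa.
have := clique_meets_part mX sKaX cKa bX; rewrite -/Kb => leKb.
apply: (sits_in_contains (X := ~: X :|: X)).
apply: sits_in_disjoint_union; first exact: sits_in_K1 vY.
  apply: (@sits_inS _ _ ([set u in [:: a; b; c; d]] :|: Kb)).
    rewrite subUset sKbX andbT; apply/subsetP => u; rewrite inE.
    exact: C4X.
  apply: sits_in_join.
  - by apply: (sits_in_C4 C4); rewrite !inE eqxx ?orbT.
  - apply: (sits_in_complete cKb) => //.
    rewrite leq_subLR add1n -ltnS; apply: leq_trans leKb.
    by rewrite -ltnS; exact: leq_trans ltK leKa.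
  have [_ _ ac bd _] := C4; move/multipartiteP: mX => mX.
  move=> u w; rewrite !inE => uC /andP[/andP[wK wa] wb].
  have wX := subsetP sKX _ wK.
  case/or4P: uC => /eqP->.
  - by rewrite edge_sym.
  - by rewrite edge_sym.
  - apply: contraLR wa => cw; apply: (mX w c a) => //.
      by rewrite edge_sym.
    by rewrite edge_sym.
  - apply: contraLR wb => cw; apply: (mX w d b) => //.
      by rewrite edge_sym.
    by rewrite edge_sym.
by move=> u w uY wX; rewrite eq_sym edge_sym eX.
Qed.

Lemma disconnected_nonpolar_contains X : P4_free G -> cut false setT X ->
  ~~ polar_set s [set: G] -> conclusion.
Proof.
move=> P4G cX npG; have cY := cut_setC cX.
have [iX|eX] := edgeless_or_edge X.
  by apply: contains_edgeless_side cY npG _; rewrite // setCK.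
have [iY|eY] := edgeless_or_edge (~: X).
  exact: contains_edgeless_side cX npG iY.
exact: contains_two_edges cX npG eX eY.
Qed.

End ContainedObstructions.

(** * The listed graphs are minimal obstructions *)

(** The clique class cannot meet both sides, so [A] contains a whole side [Z]. If [A] also has a
    vertex off [Z], any two of its vertices are non-adjacent: they are on different sides, or have a
    common non-neighbour in [A] across the cut. Then the partition is a split one; otherwise [A] is
    [Z]. *)
Lemma polar_cutP s (G : sgraph) (X : {set G}) :
  cut false setT X -> polar_set s [set: G] ->
  [\/ is_split [set: G],
      [/\ multipartite X, omega X <= s & clique (~: X)]
    | [/\ multipartite (~: X), omega (~: X) <= s & clique X]].
Proof.
move=> cX /polar_setP[A /and4P[_ mA oA]]; rewrite setTD => cB.
have main Z : cut false setT Z -> Z \subset A ->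
    is_split [set: G] \/ [/\ multipartite Z, omega Z <= s & clique (~: Z)].
  move=> cZ sZA; have eZ := cut_sits cZ; have [_ /set0Pn[z zZ] _ _] := cZ.
  have [ZA|] := boolP (A \subset Z).
    by right; have <- : A = Z by apply/eqP; rewrite eqEsubset ZA.
  case/subsetPn => y yA yZ; left; exists A; split; rewrite ?setTD //.
  have yZ' : y \in ~: Z by rewrite inE.
  have far u w : u \in Z -> w \in ~: Z -> ~~ (u -- w) /\ ~~ (w -- u).
    by move=> uZ wZ; have /andP[_ uw] := eZ u w uZ wZ; rewrite (edge_sym w).
  move=> u w uA wA; move/multipartiteP: mA => mA; apply: negbTE.
  have zA := subsetP sZA _ zZ.
  have [uZ|uZ] := boolP (u \in Z); have [wZ|wZ] := boolP (w \in Z).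
  - by apply: (mA u y w) => //; [have [] := far u y uZ yZ'|have [] := far w y wZ yZ'].
  - by have [] := far u w uZ; rewrite ?inE.
  - by have [] := far w u wZ; rewrite ?inE.
  - by apply: (mA u z w) => //; [have [] := far z u zZ|have [] := far z w zZ]; rewrite ?inE.
have [sXA|] := boolP (X \subset A).
  by have [|] := main X cX sXA; [constructor 1|constructor 2].
case/subsetPn => x xX xA.
have sYA : ~: X \subset A.
  apply/subsetP => y yX; apply: contraTT isT => yA.
  have /andP[nxy /negP] := cut_sits cX xX yX; case.
  by move/cliqueP: cB; apply; rewrite ?inE.
have [|[mY oY]] := main _ (cut_setC cX) sYA; first by constructor 1.
by rewrite setCK; constructor 3.
Qed.

Definition left_part (H1 H2 : Type) (u : H1 + H2) := if u is inl _ then true else false.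

Lemma cut_disjoint_union (H1 H2 : sgraph) (x : H1) (y : H2) :
  cut false setT [set u : disjoint_union H1 H2 | left_part u].
Proof.
split; rewrite ?subsetT //.
- by apply/set0Pn; exists (inl x); rewrite inE.
- by apply/set0Pn; exists (inr y); rewrite !inE.
by move=> [u|u] [w|w]; rewrite !inE.
Qed.

Lemma cut_copies2 (H : sgraph) (x : H) :
  cut false setT [set u : copies 2 H | u.1 == ord0].
Proof.
split; rewrite ?subsetT //.
- by apply/set0Pn; exists (ord0, x); rewrite inE.
- by apply/set0Pn; exists (ord_max, x); rewrite !inE.
move=> [i u] [j w]; rewrite !inE /= => /eqP-> /andP[nj _].
by rewrite /edge /= /copies_rel /= eq_sym (negPf nj).
Qed.

Local Notation ord n i := (@Ordinal n i isT).

Lemma nonpolar_K1_2K2 s :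
  ~~ polar_set s [set: disjoint_union (complete 1) (copies 2 (complete 2))].
Proof.
set H := disjoint_union _ _.
pose k (i j : 'I_2) : H := inr (i, j).
have H2 : is_2K2 (k (ord 2 0) (ord 2 0)) (k (ord 2 0) (ord 2 1))
                 (k (ord 2 1) (ord 2 0)) (k (ord 2 1) (ord 2 1)) by [].
have cH := @cut_disjoint_union (complete 1) (copies 2 (complete 2)) ord0 (ord0, ord0).
apply/negP => /(polar_cutP cH); case=> [|[_ _]|[+ _ _]].
- by apply: split_2K2 H2; rewrite inE.
- by apply/negP/noncliqueP; exists (k (ord 2 0) (ord 2 0)), (k (ord 2 1) (ord 2 0)); rewrite !inE.
apply/negP/nonmultipartiteP.
exists (k (ord 2 0) (ord 2 0)), (k (ord 2 1) (ord 2 0)), (k (ord 2 0) (ord 2 1)).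
by rewrite !inE.
Qed.

Lemma nonpolar_co_K2_C4 s :
  ~~ polar_set s [set: disjoint_union (complement (complete 2)) (cycle_graph 4)].
Proof.
set H := disjoint_union _ _.
pose k (i : 'I_4) : H := inr i; pose l (i : 'I_2) : H := inl i.
have C4 : is_C4 (k (ord 4 0)) (k (ord 4 1)) (k (ord 4 2)) (k (ord 4 3)) by [].
have cH := @cut_disjoint_union (complement (complete 2)) (cycle_graph 4) ord0 ord0.
apply/negP => /(polar_cutP cH); case=> [|[_ _]|[_ _]].
- by apply: split_C4 C4; rewrite inE.
- by apply/negP/noncliqueP; exists (k (ord 4 0)), (k (ord 4 2)); rewrite !inE.
by apply/negP/noncliqueP; exists (l (ord 2 0)), (l (ord 2 1)); rewrite !inE.
Qed.

Lemma nonpolar_2P3 s : ~~ polar_set s [set: copies 2 (path_graph 3)].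
Proof.
set H := copies _ _.
pose k (i : 'I_2) (j : 'I_3) : H := (i, j).
have H2 : is_2K2 (k (ord 2 0) (ord 3 0)) (k (ord 2 0) (ord 3 1))
                 (k (ord 2 1) (ord 3 0)) (k (ord 2 1) (ord 3 1)) by [].
apply/negP => /(polar_cutP (@cut_copies2 (path_graph 3) ord0)).
case=> [|[_ _]|[_ _]]; first by apply: split_2K2 H2; rewrite inE.
- by apply/negP/noncliqueP; exists (k (ord 2 1) (ord 3 0)), (k (ord 2 1) (ord 3 2)); rewrite !inE.
by apply/negP/noncliqueP; exists (k (ord 2 0) (ord 3 0)), (k (ord 2 0) (ord 3 2)); rewrite !inE.
Qed.

Lemma nonpolar_K1_coP3_join_co_K2 s :
  ~~ polar_set s [set: disjoint_union (complete 1)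
         (join (complement (path_graph 3)) (complement (complete 2)))].
Proof.
set H := disjoint_union _ _.
pose p (i : 'I_3) : H := inr (inl i); pose q (i : 'I_2) : H := inr (inr i).
have C4 : is_C4 (p (ord 3 0)) (q (ord 2 0)) (p (ord 3 1)) (q (ord 2 1)) by [].
have cH := @cut_disjoint_union (complete 1)
  (join (complement (path_graph 3)) (complement (complete 2))) ord0 (inl ord0).
apply/negP => /(polar_cutP cH); case=> [|[_ _]|[+ _ _]].
- by apply: split_C4 C4; rewrite inE.
- by apply/negP/noncliqueP; exists (p (ord 3 0)), (p (ord 3 1)); rewrite !inE.
apply/negP/nonmultipartiteP; exists (p (ord 3 0)), (p (ord 3 1)), (p (ord 3 2)).
by rewrite !inE.
Qed.

(** Uniformity in [s] matters: polarity for a single parameter, however large, certifies that a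
    graph is non-essential. *)
Lemma essential_nonpolar s (G : sgraph) : essential G -> ~~ polar_set s [set: G].
Proof.
have np H : isomorphic G H -> ~~ polar_set s [set: H] -> ~~ polar_set s [set: G].
  move/isomorphic_sym/isomorphic_contains => GH; apply: contra.
  exact: contains_polar GH.
case=> /np; apply.
- exact: nonpolar_K1_2K2.
- exact: nonpolar_co_K2_C4.
- exact: nonpolar_2P3.
- exact: nonpolar_K1_coP3_join_co_K2.
Qed.

(** Each graph contains [2K_2] or [C_4], hence is not split, so one side of the cut would have to be
    the multipartite class. That fails either because this side has a clique of size [s + 1] or
    because the other side is not a clique. *)
Lemma disconnected_family_nonpolar s (H : sgraph) : 0 < s ->
  disconnected_family s H -> ~~ polar_set s [set: H].
Proof.
move=> s_gt0 [] ->; set H' := (X in [set: X]).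
- have s1 : 0 < s + 1 by rewrite addn1.
  have lt1s : 1 < s + 1 by rewrite addn1 ltnS.
  pose k (i : 'I_2) (j : 'I_(s + 1)) : H' := (i, j).
  have H2 : is_2K2 (k (ord 2 0) (Ordinal s1)) (k (ord 2 0) (Ordinal lt1s))
                   (k (ord 2 1) (Ordinal s1)) (k (ord 2 1) (Ordinal lt1s)) by [].
  have big i (Z : {set H'}) : (forall j, k i j \in Z) -> (omega Z <= s) = false.
    move=> kZ; apply/negbTE; rewrite -ltnNge -addn1 -{1}(card_ord (s + 1)).
    have k_inj : injective (k i) by move=> j j' [].
    rewrite -cardsT -(card_imset _ k_inj); have [_ _] := max_cliqueP Z; apply.
      by apply/subsetP => u /imsetP[j _ ->].
    apply/cliqueP => u w /imsetP[j _ ->] /imsetP[j' _ ->].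
    by rewrite (inj_eq k_inj) => jj'; rewrite /edge /= /copies_rel /= eqxx.
  apply/negP => /(polar_cutP (@cut_copies2 (complete (s + 1)) (Ordinal s1))).
  case=> [|[_]|[_]]; first by apply: split_2K2 H2; rewrite inE.
    by rewrite (big ord0) // => j; rewrite inE.
  by rewrite (big ord_max) // => j; rewrite !inE.
- pose p (i : 'I_2) : H' := inl i; pose q (i : 'I_2) : H' := inr (inl i).
  pose r (i : 'I_s) : H' := inr (inr i).
  have H2 : is_2K2 (p (ord 2 0)) (p (ord 2 1)) (q (ord 2 0)) (r (Ordinal s_gt0)) by [].
  have cH := @cut_disjoint_union (complete 2)
    (join (complement (complete 2)) (complete s)) ord0 (inl ord0).
  apply/negP => /(polar_cutP cH); case=> [|[_ _]|[_ + _]].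
  + by apply: split_2K2 H2; rewrite inE.
  + by apply/negP/noncliqueP; exists (q (ord 2 0)), (q (ord 2 1)); rewrite !inE.
  apply/negP; rewrite -ltnNge.
  have r_inj : injective r by move=> j j' [].
  have [_ _] := max_cliqueP (~: [set u : H' | left_part u]).
  move/(_ (q ord0 |: [set r i | i in setT])).
  rewrite cardsU1 card_imset // cardsT card_ord.
  have -> : q ord0 \notin [set r i | i in setT] by apply/imsetP => -[].
  rewrite add1n; apply.
    by apply/subsetP => u /setU1P[|/imsetP[j _]] ->; rewrite !inE.
  apply/cliqueP => u w /setU1P[|/imsetP[j _]] -> /setU1P[|/imsetP[j' _]] -> //.
pose p : H' := inl ord0; pose q (i : 'I_4) : H' := inr (inl i).
pose r (i : 'I_(s - 1)) : H' := inr (inr i).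
have C4 : is_C4 (q (ord 4 0)) (q (ord 4 1)) (q (ord 4 2)) (q (ord 4 3)) by [].
have cH := @cut_disjoint_union (complete 1)
  (join (cycle_graph 4) (complete (s - 1))) ord0 (inl ord0).
apply/negP => /(polar_cutP cH); case=> [|[_ _]|[_ + _]].
- by apply: split_C4 C4; rewrite inE.
- by apply/negP/noncliqueP; exists (q (ord 4 0)), (q (ord 4 2)); rewrite !inE.
apply/negP; rewrite -ltnNge.
have r_inj : injective r by move=> j j' [].
have [_ _] := max_cliqueP (~: [set u : H' | left_part u]).
move/(_ (q (ord 4 0) |: (q (ord 4 1) |: [set r i | i in setT]))).
rewrite !cardsU1 card_imset // cardsT card_ord.
have -> : q (ord 4 1) \notin [set r i | i in setT] by apply/imsetP => -[].
have -> : q (ord 4 0) \notin q (ord 4 1) |: [set r i | i in setT].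
  by rewrite !inE /=; apply/imsetP => -[].
rewrite !add1n => h; apply: (@leq_trans (s - 1).+2).
  by rewrite subn1 prednK.
apply: h.
  by apply/subsetP => u /setU1P[|/setU1P[|/imsetP[j _]]] ->; rewrite !inE.
apply/cliqueP => u w /setU1P[|/setU1P[|/imsetP[j _]]] -> /setU1P[|/setU1P[|/imsetP[j' _]]] -> //.
Qed.

(** * Polarity of the listed graphs after deleting a vertex *)

(** Here and for the other three essential graphs, [c] depends on the deleted vertex [v]; 0 and 1
    name parts and 2 the clique. For an end of a [K_2], the two isolated vertices left over form one
    part and the other [K_2] is the clique. *)
Lemma polar_K1_2K2 (v : disjoint_union (complete 1) (copies 2 (complete 2))) :
  polar_set 2 (setT :\ v).
Proof.
pose c (u : disjoint_union (complete 1) (copies 2 (complete 2))) : nat :=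
  match v, u with
  | inl _, inl _ => 0
  | inl _, inr (i, j) => if nat_of_ord i == 0 then nat_of_ord j else 2
  | inr _, inl _ => 0
  | inr (i, _), inr (i', _) => if nat_of_ord i' == nat_of_ord i then 0 else 2
  end.
apply: (polar_setD1_colour (c := c)); rewrite /c.
case: v {c} => [[[|i] Hi]|[[[|[|i]] Hi] [[|[|j]] Hj]]] //;
move=> [[[|x] Hx]|[[[|[|x]] Hx] [[|[|x']] Hx']]] //;
by move=> [[[|y] Hy]|[[[|[|y]] Hy] [[|[|y']] Hy']]].
Qed.

Lemma polar_co_K2_C4 (v : disjoint_union (complement (complete 2)) (cycle_graph 4)) :
  polar_set 2 (setT :\ v).
Proof.
(* Without a cycle vertex, the one opposite to it is the clique and all the rest is independent.
   Otherwise the cycle is bipartite by parity. *)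
pose c (u : disjoint_union (complement (complete 2)) (cycle_graph 4)) : nat :=
  match v, u with
  | inl _, inl _ => 2
  | inl _, inr j => odd (nat_of_ord j)
  | inr _, inl _ => 0
  | inr i, inr j => if nat_of_ord j == (nat_of_ord i + 2) %% 4 then 2 else 0
  end.
apply: (polar_setD1_colour (c := c)); rewrite /c.
case: v {c} => [[[|[|i]] Hi]|[[|[|[|[|i]]]] Hi]] //;
move=> [[[|[|x]] Hx]|[[|[|[|[|x]]]] Hx]] //;
by move=> [[[|[|y]] Hy]|[[|[|[|[|y]]]] Hy]].
Qed.

Lemma polar_2P3 (v : copies 2 (path_graph 3)) : polar_set 2 (setT :\ v).
Proof.
(* Without a centre, the other centre is the clique and the ends are independent. Without an end,
   the [K_2] left in its copy is the clique. *)
pose c (u : copies 2 (path_graph 3)) : nat :=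
  let: (i, j) := v in let: (i', j') := u in
  if nat_of_ord j == 1 then
    (if (nat_of_ord i' != nat_of_ord i) && (nat_of_ord j' == 1) then 2 else 0)
  else (if nat_of_ord i' == nat_of_ord i then 2 else nat_of_bool (nat_of_ord j' == 1)).
apply: (polar_setD1_colour (c := c)); rewrite /c.
case: v {c} => [[[|[|i]] Hi] [[|[|[|j]]] Hj]] //;
move=> [[[|[|x]] Hx] [[|[|[|x']]] Hx']] //;
by move=> [[[|[|y]] Hy] [[|[|[|y']]] Hy']].
Qed.

Lemma polar_K1_coP3_join_co_K2 (v : disjoint_union (complete 1)
    (join (complement (path_graph 3)) (complement (complete 2)))) :
  polar_set 2 (setT :\ v).
Proof.
pose c (u : disjoint_union (complete 1)
    (join (complement (path_graph 3)) (complement (complete 2)))) : nat :=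
  match v, u with
  | inl _, inl _ => 0
  | inl _, inr (inl i) => if nat_of_ord i == 2 then 2 else 1
  | inl _, inr (inr _) => 0
  | inr (inl i), inl _ => if nat_of_ord i == 1 then 0 else 2
  | inr (inl i), inr (inl _) => if nat_of_ord i == 1 then 2 else 1
  | inr (inl i), inr (inr _) => 0
  | inr (inr _), inl _ => 0
  | inr (inr _), inr (inl i) => if nat_of_ord i == 1 then 0 else 2
  | inr (inr _), inr (inr _) => 2
  end.
apply: (polar_setD1_colour (c := c)); rewrite /c.
case: v {c} => [[[|i] Hi]|[[[|[|[|i]]] Hi]|[[|[|i]] Hi]]] //;
move=> [[[|x] Hx]|[[[|[|[|x]]] Hx]|[[|[|x]] Hx]]] //;
by move=> [[[|y] Hy]|[[[|[|[|y]]] Hy]|[[|[|y]] Hy]]].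
Qed.

Lemma critical_essential s (G : sgraph) : 1 < s -> essential G -> critical s G.
Proof.
move=> s_gt1 eG; have npG := essential_nonpolar _ eG.
have crit (H : sgraph) : (forall v : H, polar_set 2 (setT :\ v)) -> isomorphic G H -> critical s G.
  move=> pH GH; apply: (isomorphic_critical GH); split.
    by apply: contra (npG s); apply: contains_polar (isomorphic_contains GH).
  by move=> v; apply: leq_polar_set (pH v).
case: eG; apply: crit.
- exact: polar_K1_2K2.
- exact: polar_co_K2_C4.
- exact: polar_2P3.
- exact: polar_K1_coP3_join_co_K2.
Qed.

Lemma sum_eqE (A B : eqType) :
  ((forall x y : A, (inl x == inl y :> A + B) = (x == y)) *
   (forall x y : B, (inr x == inr y :> A + B) = (x == y)))%type.
Proof. by []. Qed.

Lemma polar_2K s (v : copies 2 (complete (s + 1))) : polar_set s (setT :\ v).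
Proof.
(* [unbump j] renumbers the [s] vertices left in the copy of [v] from 0, making each its own part;
   the other copy is the clique. *)
pose c (u : copies 2 (complete (s + 1))) : nat :=
  let: (i, j) := v in let: (i', j') := u in
  if nat_of_ord i' == i then unbump j j' else s.
apply: (polar_setD1_colour (c := c)); rewrite /c.
case: v {c} => i j [x x'] [y y']; rewrite !xpair_eqE /edge /= /copies_rel /=.
rewrite /edge /= /complete_rel -!(inj_eq val_inj) /=.
have lt k := ltn_ord (k : 'I_(s + 1)).
have := lt x'; have := lt y'; have := lt j; rewrite /unbump.
have := ltn_ord x; have := ltn_ord y; have := ltn_ord i.
case: (eqVneq (x : nat) i) => [->|xi]; case: (eqVneq (y : nat) i) => [->|yi] /=;
  case: ifP; (try lia); move=> *; apply/idP/idP; lia.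
Qed.

Lemma polar_K2_join s (v : disjoint_union (complete 2)
    (join (complement (complete 2)) (complete s))) :
  1 < s -> polar_set s (setT :\ v).
Proof.
move=> s_gt1.
(* The clique is, in turn, the [K_s], the [K_s] with the remaining vertex of the non-adjacent pair,
   and the [K_2]. In the second case the two ends of the [K_2] are two parts, which needs
   [s >= 2]. *)
pose c (u : disjoint_union (complete 2)
    (join (complement (complete 2)) (complete s))) : nat :=
  match v, u with
  | inl _, inr (inr _) => s
  | inl _, _ => 0
  | inr (inl _), inl i => nat_of_ord i
  | inr (inl _), _ => s
  | inr (inr _), inl _ => s
  | inr (inr j), inr (inl _) => 0
  | inr (inr j), inr (inr j') => (unbump j j').+1
  end.
apply: (polar_setD1_colour (c := c)); rewrite /c.
case: v {c} => [i|[i|i]] [x|[x|x]] [y|[y|y]]; rewrite /edge /= ?sum_eqE;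
  move: (ltn_ord i) (ltn_ord x) (ltn_ord y);
  rewrite /complement_rel /edge /= /complete_rel /cycle_rel /unbump -?(inj_eq val_inj) /=;
  case: ifP; (try lia); (try by []); move=> *; apply/idP/idP; lia.
Qed.

Lemma polar_K1_join s (v : disjoint_union (complete 1)
    (join (cycle_graph 4) (complete (s - 1)))) :
  1 < s -> polar_set s (setT :\ v).
Proof.
move=> s_gt1.
(* Without the [K_1], one vertex of [K_{s-1}] is the clique, as the join alone has [s + 1] parts.
   Without a cycle vertex, the opposite one and [K_{s-1}] form the clique. Colours 0 and 1 belong to
   the cycle, hence the shift by two in the last case. *)
pose c (u : disjoint_union (complete 1)
    (join (cycle_graph 4) (complete (s - 1)))) : nat :=
  match v, u with
  | inl _, inl _ => s
  | inl _, inr (inl k) => odd (nat_of_ord k)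
  | inl _, inr (inr j) => if nat_of_ord j == 0 then s else (nat_of_ord j).+1
  | inr (inl _), inl _ => 0
  | inr (inl k), inr (inl k') =>
      if nat_of_ord k' == (nat_of_ord k + 2) %% 4 then s else 0
  | inr (inl _), inr (inr _) => s
  | inr (inr _), inl _ => s
  | inr (inr _), inr (inl k) => odd (nat_of_ord k)
  | inr (inr j), inr (inr j') => (unbump j j').+2
  end.
apply: (polar_setD1_colour (c := c)); rewrite /c.
case: v {c} => [i|[i|i]] [x|[x|x]] [y|[y|y]]; rewrite /edge /= ?sum_eqE;
  move: (ltn_ord i) (ltn_ord x) (ltn_ord y);
  rewrite /complement_rel /edge /= /complete_rel /cycle_rel /unbump -?(inj_eq val_inj) /=;
  do ?[case: ifP; (try lia)]; (try by []); move=> *; apply/idP/idP; lia.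
Qed.

Lemma critical_disconnected_family s (H : sgraph) : 1 < s ->
  disconnected_family s H -> critical s H.
Proof.
move=> s_gt1 fH; split; first exact: disconnected_family_nonpolar (ltnW s_gt1) fH.
by case: fH => -> v; [exact: polar_2K|exact: polar_K2_join|exact: polar_K1_join].
Qed.

Lemma co_matching_edge n (u w : complement (copies n (complete 2))) :
  (u -- w) = (u.1 != w.1).
Proof.
case: u w => [i j] [i' j']; rewrite complementE /edge /= /copies_rel /edge /= /complete_rel.
by rewrite xpair_eqE; case: (i == i'); case: (j == j').
Qed.

(** The clique class cannot contain both vertices of a non-adjacent pair, so [A] meets all [s + 1]
    pairs and has a clique of that size. After deleting [v], its partner is the clique and the other
    pairs are the [s] parts. *)
Lemma critical_co_matching s : critical s (complement (copies (s + 1) (complete 2))).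
Proof.
set H := complement _; have HE := @co_matching_edge (s + 1).
split.
  apply/negP => /polar_setP[A /and4P[_ _ /omega_leP oA]]; rewrite setTD => /cliqueP cB.
  have side i : exists j : 'I_2, ((i, j) : H) \in A.
    have [|nA0] := boolP (((i, ord0) : H) \in A); first by exists ord0.
    exists ord_max; apply: contraTT isT => nA1.
    have := cB (i, ord0) (i, ord_max).
    by rewrite HE eqxx !inE => /(_ nA0 nA1); rewrite xpair_eqE andbF => /(_ isT).
  pose f (i : 'I_(s + 1)) : H := (i, xchoose (side i)).
  have f_inj : injective f by move=> i i' [].
  have := oA [set f i | i in setT]; rewrite card_imset // cardsT card_ord => le_s1s.
  suff: s + 1 <= s by rewrite addn1 ltnn.
  apply: le_s1s.
    by apply/subsetP => _ /imsetP[i _ ->]; exact: (xchooseP (side i)).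
  apply/cliqueP => _ _ /imsetP[i _ ->] /imsetP[i' _ ->]; rewrite HE.
  by apply: contraNN => /eqP /= ->.
move=> v.
apply: (polar_setD1_colour
  (c := fun u : H => if nat_of_ord u.1 == v.1 then s else unbump v.1 u.1)).
case: v => i j [x x'] [y y']; rewrite !HE /= !xpair_eqE.
rewrite -!(inj_eq val_inj) /= /unbump.
have := ltn_ord (x : 'I__); have := ltn_ord (y : 'I__); have := ltn_ord (i : 'I__).
have := ltn_ord (x' : 'I_2); have := ltn_ord (y' : 'I_2); have := ltn_ord (j : 'I_2).
do ?[case: ifP; (try lia)]; (try by []); move=> *; apply/idP/idP; lia.
Qed.

(** * Disconnected obstructions *)

Lemma contains_complete m n : m <= n -> contains_induced (complete n) (complete m).
Proof.
move=> le_mn; exists (widen_ord le_mn); split=> [i j|i j].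
  by move/(congr1 val) => /= ij; exact: val_inj.
by rewrite /edge /= /complete_rel -!(inj_eq val_inj).
Qed.

Lemma contains_disjoint_union (G1 G2 H1 H2 : sgraph) :
  contains_induced G1 H1 -> contains_induced G2 H2 ->
  contains_induced (disjoint_union G1 G2) (disjoint_union H1 H2).
Proof.
move=> [f [f_inj fE]] [g [g_inj gE]].
exists (fun u => match u with inl x => inl (f x) | inr y => inr (g y) end).
split=> [] [x|x] [y|y] //; rewrite /edge /=; rewrite ?fE ?gE //.
  by move=> [/f_inj->].
by move=> [/g_inj->].
Qed.

Lemma contains_join (G1 G2 H1 H2 : sgraph) :
  contains_induced G1 H1 -> contains_induced G2 H2 ->
  contains_induced (join G1 G2) (join H1 H2).
Proof.
move=> [f [f_inj fE]] [g [g_inj gE]].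
exists (fun u => match u with inl x => inl (f x) | inr y => inr (g y) end).
split=> [] [x|x] [y|y] //; rewrite /edge /=; rewrite ?fE ?gE //.
  by move=> [/f_inj->].
by move=> [/g_inj->].
Qed.

Lemma contains_copies n (G H : sgraph) :
  contains_induced G H -> contains_induced (copies n G) (copies n H).
Proof.
move=> [f [f_inj fE]]; exists (fun u : 'I_n * H => (u.1, f u.2)); split.
  by move=> [i x] [j y] [-> /f_inj->].
by move=> [i x] [j y]; rewrite /edge /= /copies_rel /= fE.
Qed.

Lemma contains_refl (G : sgraph) : contains_induced G G.
Proof. by exists id; split=> // x y. Qed.

Lemma contains_trans (G H K : sgraph) :
  contains_induced G H -> contains_induced H K -> contains_induced G K.
Proof.
move=> [f [f_inj fE]] [g [g_inj gE]]; exists (f \o g); split.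
  exact: inj_comp.
by move=> x y; rewrite /= fE gE.
Qed.

Lemma card_contains (G H : sgraph) : contains_induced G H -> #|H| <= #|G|.
Proof. by move=> [f [f_inj _]]; exact: leq_card f_inj. Qed.

Lemma disconnected_family_pred s (H : sgraph) : 0 < s ->
  disconnected_family s.+1 H -> exists2 H', disconnected_family s H' &
    contains_induced H H' /\ #|H'| < #|H|.
Proof.
move=> s_gt0 [] ->.
- exists (copies 2 (complete (s + 1))); first by constructor 1.
  split; first by apply: contains_copies; apply: contains_complete; lia.
  by rewrite !card_prod !card_ord; lia.
- exists (disjoint_union (complete 2) (join (complement (complete 2)) (complete s))).
    by constructor 2.
  split; last by rewrite !card_sum !card_ord; lia.
  apply: contains_disjoint_union; first exact: contains_refl.
  apply: contains_join; first exact: contains_refl.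
  exact: contains_complete.
exists (disjoint_union (complete 1) (join (cycle_graph 4) (complete (s - 1)))).
  by constructor 3.
split; last by rewrite !card_sum !card_ord; lia.
apply: contains_disjoint_union; first exact: contains_refl.
apply: contains_join; first exact: contains_refl.
by apply: contains_complete; lia.
Qed.

(** For positive [s], the family member for [s + 1] inside [G] properly contains the one for [s],
    and a vertex missed by the smaller graph can be deleted. *)
Lemma nonpolar_descent s (G : sgraph) (X : {set G}) : P4_free G ->
  cut false setT X -> ~ contains_essential G -> ~~ polar_set s.+1 [set: G] ->
  exists x : G, ~~ polar_set s (setT :\ x).
Proof.
move=> P4G cX neG npG; have [s0|s_gt0] := posnP s; last first.
  have [//|[H fH GH]] := disconnected_nonpolar_contains (ltn0Sn s) P4G cX npG.
  have [H' fH' [HH' ltH']] := disconnected_family_pred s_gt0 fH.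
  apply: (contains_nonpolar_small (contains_trans GH HH')).
    exact: disconnected_family_nonpolar fH'.
  exact: leq_trans ltH' (card_contains GH).
(* For parameter 0, suppose all vertex deletions leave cliques. Then a non-adjacent pair taken
   across the cut, with the clique formed by the rest, is a split partition. *)
subst s; apply/existsP; apply: contraNT npG; rewrite negb_exists => /forallP all_cl.
have {}all_cl (x : G) : clique (setT :\ x) by have := all_cl x; rewrite negbK polar_set0.
have [_ /set0Pn[x xX] /set0Pn[y]] := cX; rewrite inE => /andP[yX _] eX.
have nxy : x != y by apply: contraNneq yX => <-.
have xy : ~~ (x -- y) by rewrite eX // !inE yX.
apply: polar_split => //; exists [set x; y]; split; rewrite ?subsetT //.
  move=> u w /set2P[]-> /set2P[]->; rewrite ?edge_irrefl ?(negbTE xy) //.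
  by rewrite edge_sym; exact: negbTE.
apply/cliqueP => u w; rewrite !inE !andbT !negb_or => /andP[ux uy] /andP[wx wy].
by move=> uw; have /cliqueP := all_cl x; apply; rewrite ?inE ?ux ?wx.
Qed.

Lemma P4_free_contains (G H : sgraph) :
  contains_induced G H -> P4_free G -> P4_free H.
Proof.
move=> [f [f_inj fE]] P4G a b c d; rewrite -!fE; exact: P4G.
Qed.

Lemma disconnectedP (G : sgraph) :
  disconnected G <-> exists X : {set G}, cut false setT X.
Proof.
split=> [dG|[X [_ /set0Pn[x xX] /set0Pn[y]]]]; last first.
  rewrite inE => /andP[yX _] eX conn; move: (conn x y).
  have cl : closed (@edge G) (mem X).
    apply: (intro_closed (sym_connect_sym (@edge_sym G))).
    move=> u w uw uX; apply: contraTT uw => wX.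
    by rewrite eX // !inE wX.
  by move/(closed_connect cl) => /=; rewrite xX (negPf yX).
have [/forallP conn|] := boolP [forall x : G, forall y : G, connect (@edge G) x y].
  by case: dG => x y; move/forallP: (conn x); exact.
rewrite negb_forall => /existsP[x]; rewrite negb_forall => /existsP[y xy].
exists [set z | connect (@edge G) x z]; split; rewrite ?subsetT //.
- by apply/set0Pn; exists x; rewrite inE connect0.
- by apply/set0Pn; exists y; rewrite !inE xy.
move=> u w; rewrite !inE andbT => xu; apply: contraNF => uw.
exact: connect_trans xu (connect1 uw).
Qed.

(** An essential graph inside [G] would be all of [G], so the descent applies and contradicts
    criticality. Thus the least parameter for which [G] is polar is exactly [s + 1]. *)
Lemma critical_disconnected_polarS s (G : sgraph) : P4_free G -> disconnected G ->
  ~ essential G -> critical s G -> polar_set s.+1 [set: G].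
Proof.
move=> P4G /disconnectedP[X cX] neG cG; have [npG minG] := cG.
apply: contraT => npG'.
have [|x] := nonpolar_descent P4G cX _ npG'; last by rewrite minG.
move=> [H eH GH]; apply: neG.
have GiH := critical_isomorphic cG GH (essential_nonpolar _ eH).
exact: isomorphic_essential GiH eH.
Qed.

(** * Joins *)

Section Join.
Variables (G : sgraph) (P : {set {set G}}).
Hypothesis partP : partition P [set: G].
Hypothesis joinP : forall x y : G, pblock P x != pblock P y -> x -- y.
Implicit Types (A C K S : {set G}).

Lemma pblock_in x : pblock P x \in P.
Proof. by have [/eqP covP _ _] := and3P partP; apply: pblock_mem; rewrite covP inE. Qed.

Lemma mem_block C x : C \in P -> (x \in C) = (pblock P x == C).
Proof.
move=> CP; have [/eqP covP tI _] := and3P partP.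
apply/idP/eqP => [xC|<-]; first exact: def_pblock.
by rewrite mem_pblock covP inE.
Qed.

Lemma card_blocks K : #|K| = \sum_(C in P) #|K :&: C|.
Proof.
rewrite -sum1_card (partition_big (pblock P) (mem P)) => [|x _]; last exact: pblock_in.
apply: eq_bigr => C CP; rewrite -sum1_card; apply: eq_bigl => x.
by rewrite inE (@mem_block C).
Qed.

(** The blocks are completely joined, so the union of maximum cliques of the sets [A :&: C] is a
    clique of [A], and the numbers [omega (A :&: C)] add up to at most [s]. *)
Lemma polar_join_parts s S : polar_set s S ->
  exists k : {set G} -> nat,
    (forall C, C \in P -> polar_set (k C) (S :&: C)) /\ \sum_(C in P) k C <= s.
Proof.
move=> /polar_setP[A /and4P[sAS mA /omega_leP oA cB]].
exists (fun C => omega (A :&: C)); split=> [C CP|].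
  apply/polar_setP; exists (A :&: C); apply/and4P; split=> //.
  - exact: setSI.
  - by apply: submultipartite mA; exact: subsetIl.
  apply: subclique cB; apply/subsetP => x; rewrite !inE => /andP[+ /andP[-> xC]].
  by rewrite xC !andbT.
pose K := [set x | x \in max_clique (A :&: pblock P x)].
have KC C : C \in P -> K :&: C = max_clique (A :&: C).
  move=> CP; have [/subsetP sM _ _] := max_cliqueP (A :&: C).
  apply/setP => x; rewrite !inE andbC; apply/andP/idP => [[]|xM].
    by rewrite mem_block // => /eqP->.
  have := sM x xM; rewrite inE => /andP[_ xC].
  by rewrite xC; move: xC; rewrite mem_block // => /eqP->.
rewrite (_ : \sum_(C in P) _ = #|K|); last first.
  by rewrite card_blocks; apply: eq_bigr => C CP; rewrite KC.
apply: oA.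
  apply/subsetP => x; rewrite inE.
  have [/subsetP sM _ _] := max_cliqueP (A :&: pblock P x).
  by move/sM; rewrite inE => /andP[].
apply/cliqueP => x y; rewrite !inE => xM yM nxy.
have [pxy|] := eqVneq (pblock P x) (pblock P y); last exact: joinP.
have [_ /cliqueP cM _] := max_cliqueP (A :&: pblock P x).
by apply: cM; rewrite // pxy.
Qed.

(** The union of witnesses works: non-adjacency never leaves a block, and a clique of the union
    splits into one clique per block. *)
Lemma polar_join s S (k : {set G} -> nat) :
  (forall C, C \in P -> polar_set (k C) (S :&: C)) -> \sum_(C in P) k C <= s ->
  polar_set s S.
Proof.
move=> pS le_s.
(* The default [set0] is never taken on blocks of [P], where a witness exists. *)
pose W C := odflt set0 [pick A | polar_witness (k C) (S :&: C) A].
have WP C : C \in P -> polar_witness (k C) (S :&: C) (W C).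
  move=> /pS/polar_setP[A wA]; rewrite /W; case: pickP => // /(_ A).
  by rewrite wA.
pose A := [set x | x \in W (pblock P x)].
have WA x : x \in A -> x \in W (pblock P x) by rewrite inE.
have sub C : C \in P -> W C \subset S :&: C by move/WP => /and4P[].
have AS : A \subset S.
  apply/subsetP => x /WA/(subsetP (sub _ (pblock_in x))).
  by rewrite inE => /andP[].
apply/polar_setP; exists A; apply/and4P; split=> //.
- have same x y : ~~ (x -- y) -> pblock P x = pblock P y.
    by move=> xy; apply/eqP; apply: contraNT xy; exact: joinP.
  apply/multipartiteP => x y z /WA xA /WA yA /WA zA xy yz.
  have /and4P[_ /multipartiteP mW _ _] := WP _ (pblock_in x).
  apply: (mW x y z) => //; first by rewrite (same _ _ xy).
  by rewrite (same _ _ xy) (same _ _ yz).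
- apply/omega_leP => K /subsetP sKA cK; apply: leq_trans le_s.
  rewrite card_blocks; apply: leq_sum => C CP.
  have /and4P[_ _ /omega_leP oW _] := WP C CP.
  apply: oW; last by apply: subclique cK; exact: subsetIl.
  apply/subsetP => x; rewrite inE => /andP[/sKA/WA xW].
  by rewrite (@mem_block C) // => /eqP pC; rewrite -pC.
apply/cliqueP => x y; rewrite !inE => /andP[xA xS] /andP[yA yS] nxy.
have [pxy|] := eqVneq (pblock P x) (pblock P y); last exact: joinP.
have /and4P[_ _ _ /cliqueP cW] := WP _ (pblock_in x).
apply: cW => //; first by rewrite inE xA inE xS (@mem_block (pblock P x)) ?pblock_in // eqxx.
by rewrite inE pxy yA inE yS (@mem_block (pblock P y)) ?pblock_in // eqxx.
Qed.

End Join.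

(** * Co-components and their least parameters *)

Lemma connect_equivalence (G : sgraph) :
  {in [set: G] & &, equivalence_rel (connect (@edge G))}.
Proof.
move=> x y z _ _ _; split=> [|xy]; first exact: connect0.
by rewrite (same_connect (sym_connect_sym (@edge_sym G)) xy).
Qed.

Lemma components_partition (G : sgraph) : partition (components G) [set: G].
Proof. exact/equivalence_partitionP/connect_equivalence. Qed.

Lemma component_connect (G : sgraph) (C : {set G}) x y : C \in components G ->
  x \in C -> (y \in C) = connect (@edge G) x y.
Proof.
move=> CP xC; have [_ tI _] := and3P (components_partition G).
rewrite -(def_pblock tI CP xC) pblock_equivalence_partition ?inE //.
exact: connect_equivalence.
Qed.

Lemma co_components_join (G : sgraph) (x y : G) :
  pblock (components (complement G)) x != pblock (components (complement G)) y ->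
  x -- y.
Proof.
set P := components _; have partP := components_partition (complement G).
apply: contraR => xy; apply/eqP/esym/eqP.
rewrite -(mem_block partP) ?(pblock_in partP) //.
rewrite (@component_connect (complement G) _ x) ?(pblock_in partP) //.
  have [->|nxy] := eqVneq x y; first exact: connect0.
  by apply: connect1; rewrite complementE nxy.
by rewrite (mem_block partP) ?(pblock_in partP).
Qed.

(** A join inside [C] would separate [C] in the complement, where it is connected. *)
Lemma co_component_cut (G : sgraph) (C X : {set G}) b :
  C \in components (complement G) -> cut b C X -> b = false.
Proof.
move=> CP; case: b => // -[sXC /set0Pn[x xX] /set0Pn[y /setDP[yC yX]] eX].
have cl : closed (@edge (complement G)) (mem X).
  apply: (intro_closed (sym_connect_sym (@edge_sym (complement G)))).
  move=> u w uw uX; have uC := subsetP sXC _ uX.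
  have wC : w \in C by rewrite (component_connect _ CP uC); exact: connect1.
  have := uw; rewrite complementE => /andP[_]; apply: contraNT => wX.
  by apply: eX; rewrite // inE wX.
have := yC; rewrite (component_connect _ CP (subsetP sXC _ xX)).
by move/(closed_connect cl) => /=; rewrite xX (negPf yX).
Qed.

Lemma cut_disconnected_induced (G : sgraph) (S X : {set G}) :
  cut false S X -> disconnected (induced S).
Proof.
move=> [sXS /set0Pn[x xX] /set0Pn[y /setDP[yS yX]] eX]; apply/disconnectedP.
exists [set u : induced S | sval u \in X]; split; rewrite ?subsetT //.
- by apply/set0Pn; exists (exist _ x (subsetP sXS _ xX)); rewrite inE.
- by apply/set0Pn; exists (exist _ y yS); rewrite !inE yX.
move=> u w; rewrite !inE andbT => uX wX; apply: eX => //.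
by rewrite inE wX; exact: (valP w).
Qed.

Lemma polar_set_induced s (G : sgraph) (S : {set G}) :
  polar_set s [set: induced S] = polar_set s S.
Proof. by apply/idP/idP => [/polarP/polar_inducedP|/polar_inducedP/polarP]. Qed.

Lemma critical_inducedP s (G : sgraph) (S : {set G}) :
  critical s (induced S) <->
  ~~ polar_set s S /\ forall x, x \in S -> polar_set s (S :\ x).
Proof.
have imD (u : induced S) : sval @: ([set: induced S] :\ u) = S :\ sval u.
  apply/setP => x; rewrite !inE; apply/imsetP/andP => [[w wu ->]|[nx xS]].
    move: wu; rewrite !inE andbT -(inj_eq val_inj) => wu.
    by split=> //; exact: (valP w).
  by exists (exist _ x xS); rewrite // !inE andbT -(inj_eq val_inj).
have imE u : polar_set s (S :\ sval u) = polar_set s ([set: induced S] :\ u).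
  by rewrite -(@polar_set_imset G (induced S) sval) ?imD //; exact: val_inj.
rewrite /critical polar_set_induced; split=> -[npS minS]; split=> //.
  by move=> x xS; rewrite (imE (exist _ x xS)).
by move=> u; rewrite -imE; apply: minS; exact: (valP u).
Qed.

Lemma induced_complement_iso (G : sgraph) (C : {set G}) :
  isomorphic (@induced (complement G) C) (complement (induced C)).
Proof. by exists id; split=> //; exists id. Qed.

Lemma isomorphic_of_complement (G H : sgraph) (C : {set G}) :
  isomorphic (@induced (complement G) C) (complement H) -> isomorphic (induced C) H.
Proof.
move=> [f [f_bij fE]]; exists f; split=> // x y.
have fxy := fE x y; move: fxy; rewrite complementE.
case: (altP (x =P y)) => [->|nxy]; first by rewrite !edge_irrefl.
rewrite (inj_eq (bij_inj f_bij)) nxy /=.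
rewrite /complement_rel (inj_eq val_inj) nxy /=.
by move/negb_inj.
Qed.

(** The blocks are retyped as sets of vertices of [G], so that [induced] and [polar_set] use the
    edges of [G] and not those of the complement. *)
Definition co_components (G : sgraph) : {set {set G}} := components (complement G).

Section CoComponents.
Variables (s : nat) (G : sgraph).
Hypothesis P4G : P4_free G.
Local Notation P := (co_components G).
Let partP : partition P [set: G] := components_partition (complement G).

Lemma critical_join (k : {set G} -> nat) :
  (forall C : {set G}, C \in P -> [/\ critical (k C) (induced C) &
     polar_set (k C).+1 C]) ->
  \sum_(C in P) (k C).+1 = s.+1 -> critical s G.
Proof.
move=> kP sumk; split.
  apply/negP => /(@polar_join_parts G P partP (@co_components_join G))[n [nP sumn]].
  have le_kn : \sum_(C in P) (k C).+1 <= \sum_(C in P) n C; last first.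
    by have := leq_trans le_kn sumn; rewrite sumk ltnn.
  apply: leq_sum => C CP; rewrite ltnNge; apply/negP => le_nk.
  have [/critical_inducedP[/negP npC _] _] := kP C CP; apply: npC.
  by apply: leq_polar_set le_nk _; have := nP C CP; rewrite setTI.
move=> x; pose C0 := pblock P x.
have C0P : C0 \in P := @pblock_in G P partP x.
(* Deleting [x] saves one in its own block, which brings the total from [s + 1] down to [s]. *)
apply: (@polar_join G P partP (@co_components_join G) _ _
  (fun C => if C == C0 then k C else (k C).+1)) => [C CP|].
  have [/critical_inducedP[_ minC] polC] := kP C CP.
  case: (eqVneq C C0) => [CE|_].
    have xC : x \in C by rewrite (@mem_block G P partP) // CE.
    by apply: polar_setS (minC x xC); apply/subsetP => y; rewrite !inE andbT.
  by apply: polar_setS polC; exact: subsetIr.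
move: sumk; rewrite !(bigD1 C0 C0P) /= eqxx addSn => -[<-].
rewrite leq_add2l; apply: eq_leq; apply: eq_bigr => C /andP[_ /negPf->] //.
Qed.

Hypothesis cG : critical s G.

Lemma critical_parts (X : {set G}) : cut true setT X ->
  exists m : {set G} -> nat,
    \sum_(C in P) m C = s.+1 /\
    (forall C : {set G}, C \in P ->
       [/\ 0 < m C, ~~ clique C, disconnected (induced C),
           critical (m C).-1 (induced C) & polar_set (m C) C]).
Proof.
move=> cX; have [npG minG] := cG.
(* A co-component cannot be all of [G], which is a join; it misses a vertex, and criticality
   applies. *)
have polC C : C \in P -> polar_set s C.
  move=> CP; have [CT|] := boolP ([set: G] \subset C).
    have CE : C = setT by apply/eqP; rewrite eqEsubset subsetT.
    by rewrite -CE in cX; have := co_component_cut CP cX.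
  case/subsetPn => x _ xC; apply: polar_setS (minG x).
  by apply/subsetP => y yC; rewrite !inE andbT; apply: contraNneq xC => <-.
(* The alternative [s <= n] makes the minimum defined for every set; on co-components the minimum is
   a true polarity parameter. *)
have exm (C : {set G}) : exists n, polar_set n C || (s <= n).
  by exists s; rewrite leqnn orbT.
pose m C := ex_minn (exm C).
have mP C : C \in P -> polar_set (m C) C.
  move=> CP; rewrite /m; case: ex_minnP => n /orP[//|le_sn _].
  exact: leq_polar_set le_sn (polC C CP).
have m_min n C : polar_set n C -> m C <= n.
  by move=> pn; rewrite /m; case: ex_minnP => n' _; apply; rewrite pn.
have ltsM : s < \sum_(C in P) m C.
  rewrite ltnNge; apply: contra npG.
  apply: (@polar_join G P partP (@co_components_join G) _ _ m) => // C CP.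
  by rewrite setTI; exact: mP.
(* The other blocks keep all their vertices and still require their full [m], so [C :\ x] gets only
   what they leave of [s]. *)
have drop C x : C \in P -> x \in C ->
    exists2 n, polar_set n (C :\ x) & n + \sum_(C in P) m C <= s + m C.
  move=> CP xC; have [n [nP sumn]] :=
    @polar_join_parts G P partP (@co_components_join G) _ _ (minG x).
  exists (n C).
    by apply: polar_setS (nP C CP); apply/subsetP => y; rewrite !inE andbT.
  have le_rest : \sum_(D in P | D != C) m D <= \sum_(D in P | D != C) n D.
    apply: leq_sum => D /andP[DP nDC]; apply: m_min.
    apply: polar_setS (nP D DP); apply/subsetP => y yD; rewrite !inE yD !andbT.
    apply: contraNneq nDC => yx; rewrite -(eqP (_ : pblock P x == D)).
      by rewrite -(@mem_block G P partP).
    by rewrite -(@mem_block G P partP) // -yx.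
  move: sumn; rewrite !(bigD1 C CP) /=; move: le_rest.
  by set a := \sum_(D in P | _) _; set b := \sum_(D in P | _) _; clear; lia.
have m_gt0 C : C \in P -> 0 < m C.
  move=> CP; have [_ _ P0] := and3P partP.
  have /set0Pn[x xC] : C != set0 by apply: contraNneq P0 => <-.
  by have [n _] := drop C x CP xC; move: ltsM; clear; lia.
have critC C : C \in P -> critical (m C).-1 (induced C).
  move=> CP; have mC := m_gt0 C CP; apply/critical_inducedP; split.
    by apply/negP => /m_min; rewrite -ltnS prednK ?ltnn.
  move=> x xC; have [n pn le_n] := drop C x CP xC.
  by apply: leq_polar_set pn; move: ltsM le_n mC; clear; lia.
have ncC C : C \in P -> ~~ clique C.
  move=> CP; apply/negP => cC; have := m_gt0 C CP.
  by rewrite ltnNge m_min // polar_set0.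
have disC C : C \in P -> disconnected (induced C).
  move=> CP; have /noncliqueP[x [y [xC yC nxy _]]] := ncC C CP.
  have C_gt1 : 1 < #|C|.
    rewrite ltnNge; apply/negP => /card_le1_eqP/(_ x y xC yC) xy.
    by rewrite xy eqxx in nxy.
  have [b [Y cY]] := cut_exists P4G C_gt1.
  have b0 := co_component_cut CP cY; subst b.
  exact: cut_disconnected_induced cY.
exists m; split; last by move=> C CP; split; auto.
(* A sum above [s + 1] would make each deletion in [C] lower its parameter by two or more, so [C]
   would be critical for [m C - 2], hence polar for [m C - 1], against the minimality of [m C]. *)
apply/eqP; rewrite eqn_leq ltsM andbT leqNgt; apply/negP => ltM.
have [x _] : exists x : G, true.
  by have [_ /set0Pn[x _] _ _] := cX; exists x.
set C := pblock P x; have CP : C \in P := @pblock_in G P partP x.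
have xC : x \in C by rewrite (@mem_block G P partP).
have m_gt1 : 1 < m C.
  by have [n _] := drop C x CP xC; move: ltM; clear; lia.
have critC' : critical (m C).-2 (induced C).
  apply/critical_inducedP; split.
    by apply/negP => /m_min; move: m_gt1; clear; lia.
  move=> y yC; have [n pn le_n] := drop C y CP yC.
  by apply: leq_polar_set pn; move: ltM le_n m_gt1; clear; lia.
have neC : ~ essential (induced C).
  by move/(essential_nonpolar (m C)); rewrite polar_set_induced mP.
have P4C : P4_free (induced C).
  by apply: P4_free_contains P4G; exists sval; split=> // u w; exact: val_inj.
have := critical_disconnected_polarS P4C (disC C CP) neC critC'.
rewrite polar_set_induced => /m_min; move: m_gt1; clear; lia.
Qed.

End CoComponents.

Lemma cograph_induced (G : sgraph) (S : {set G}) : cograph G -> cograph (induced S).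
Proof.
move=> cG SP4; apply: cG; apply: contains_trans SP4.
by exists sval; split=> // x y; exact: val_inj.
Qed.

Lemma join_of_obstructions_critical s (G : sgraph) :
  join_of_obstructions s G -> critical s G.
Proof.
move=> [_ le_ts [k [kP sumk]]]; apply: (@critical_join s G k) => [C CP|].
  have [K [CK neK dK /minimal_polar_obstructionP[cK critK]]] := kP C CP.
  have GK := isomorphic_of_complement CK.
  split; first exact: isomorphic_critical GK critK.
  rewrite -polar_set_induced; apply: contains_polar (isomorphic_contains GK) _.
  exact: critical_disconnected_polarS (cograph_P4_free cK) dK neK critK.
have -> : \sum_(C in co_components G) (k C).+1
    = \sum_(C in co_components G) k C + #|co_components G|.
  by rewrite -sum1_card -big_split; apply: eq_bigr => C _; rewrite /= addn1.
have -> : \sum_(C in co_components G) k C = s - #|co_components G| + 1 := sumk.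
(* The truncated subtraction is exact because there are at most [s] co-components. *)
by rewrite addn1 addSn subnK.
Qed.

(** One non-adjacent pair is chosen in each of the [s + 1] co-components; distinct co-components are
    completely joined. *)
Lemma co_matching_contained s (G : sgraph) :
  #|co_components G| = s + 1 ->
  (forall C, C \in co_components G -> ~~ clique C) ->
  contains_induced G (complement (copies (s + 1) (complete 2))).
Proof.
move=> cardP ncP; have partP : partition (co_components G) [set: G].
  exact: (components_partition (complement G)).
have memP := @mem_block G _ partP.
pose C (i : 'I_(s + 1)) : {set G} := enum_val (cast_ord (esym cardP) i).
have CP i : C i \in co_components G by exact: enum_valP.
have C_inj : injective C by move=> i j /enum_val_inj/cast_ord_inj.
pose nonadjacent i := [pred p : G * G |
  [&& p.1 \in C i, p.2 \in C i, p.1 != p.2 & ~~ (p.1 -- p.2)]].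
have exP i : exists p, nonadjacent i p.
  have /noncliqueP[x [y [xC yC nxy xy]]] := ncP _ (CP i).
  by exists (x, y); rewrite /= xC yC nxy.
pose p i := xchoose (exP i).
pose f (u : 'I_(s + 1) * 'I_2) := if u.2 == ord0 then (p u.1).1 else (p u.1).2.
have pP i : nonadjacent i (p i) := xchooseP (exP i).
have fC u : pblock (co_components G) (f u) = C u.1.
  apply/eqP; rewrite -memP //; have /and4P[p1 p2 _ _] := pP u.1.
  by rewrite /f; case: eqP.
have f_fst u w : u.1 != w.1 -> f u -- f w.
  move=> uw; apply: co_components_join; rewrite -/(co_components G).
  by rewrite -[pblock _ _]/(pblock (co_components G) (f u)) !fC (inj_eq C_inj).
have f_same i j j' : (f (i, j) == f (i, j')) = (j == j') /\ ~~ (f (i, j) -- f (i, j')).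
  have /and4P[_ _ n12 e12] := pP i; rewrite /f /=.
  case: j j' => [[|[|j]] Hj] [[|[|j']] Hj'] //=;
    rewrite ?eqxx ?edge_irrefl ?(negPf n12) ?e12 //.
  by rewrite eq_sym (negPf n12) edge_sym e12.
exists f; split=> [[i j] [i' j'] fE|[i j] [i' j']]; last first.
  rewrite co_matching_edge /=; have [->|ii'] := eqVneq i i'.
    by have [_ /negPf] := f_same i' j j'.
  exact: f_fst.
have [ii'|ii'] := eqVneq i i'.
  by subst i'; have [eqf _] := f_same i j j'; move: eqf; rewrite fE eqxx => /esym/eqP->.
have := f_fst (i, j) (i', j') ii'.
by rewrite fE edge_irrefl.
Qed.

Lemma critical_join_cases s (G : sgraph) (X : {set G}) :
  cograph G -> critical s G -> cut true setT X ->
  isomorphic G (complement (copies (s + 1) (complete 2))) \/ join_of_obstructions s G.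
Proof.
move=> cG critG cX; have P4G := cograph_P4_free cG.
have [m [summ mP]] := critical_parts P4G critG cX.
have sum_pred : \sum_(C in co_components G) (m C).-1 + #|co_components G| = s + 1.
  rewrite addn1 -summ -sum1_card -big_split; apply: eq_bigr => C CP.
  by have [m_gt0 _ _ _ _] := mP C CP; rewrite /= addn1 prednK.
have [le_ts|lt_st] := leqP #|co_components G| s.
  right; split=> //.
    apply/disconnectedP; exists X.
    by have /(cut_complement false) := cX.
  exists (fun C => (m C).-1); split=> [C CP|]; last first.
    change (\sum_(C in co_components G) (m C).-1 = s - #|co_components G| + 1).
    by lia.
  have [_ _ dC critC polC] := mP C CP; exists (induced (C : {set G})).
  (* [C] is polar for [m C], hence not essential. *)
  split=> //; first exact: induced_complement_iso.
    move/(essential_nonpolar (m C)); rewrite polar_set_induced.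
    by rewrite polC.
  by apply/minimal_polar_obstructionP; split=> //; exact: cograph_induced.
left; apply: (critical_isomorphic critG); last first.
  by have [] := critical_co_matching s.
apply: co_matching_contained => [|C CP]; first by lia.
by have [] := mP C CP.
Qed.

Theorem theorem10 (G : sgraph) (s : nat) (hG : cograph G) (hs : 2 <= s) :
  minimal_polar_obstruction s 1 G <->
  essential G \/
  isomorphic G (copies 2 (complete (s + 1))) \/
  isomorphic G
    (disjoint_union (complete 2)
       (join (complement (complete 2)) (complete s))) \/
  isomorphic G
    (disjoint_union (complete 1) (join (cycle_graph 4) (complete (s - 1)))) \/
  isomorphic G (complement (copies (s + 1) (complete 2))) \/
  join_of_obstructions s G.
Proof.
have fam H : isomorphic G H -> disconnected_family s H -> critical s G.
  by move=> GH fH; apply: isomorphic_critical GH (critical_disconnected_family hs fH).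
split=> [/minimal_polar_obstructionP[_ critG]|listG]; last first.
  apply/minimal_polar_obstructionP; split=> //.
  case: listG => [eG|[GH|[GH|[GH|[GH|jG]]]]].
  - exact: critical_essential.
  - by apply: fam GH _; constructor 1.
  - by apply: fam GH _; constructor 2.
  - by apply: fam GH _; constructor 3.
  - exact: isomorphic_critical GH (critical_co_matching s).
  - exact: join_of_obstructions_critical.
have P4G := cograph_P4_free hG; have [npG _] := critG.
have G_gt1 : 1 < #|[set: G]|.
  rewrite ltnNge; apply: contra npG => /card_le1_eqP G1.
  by apply: polar_clique; apply/cliqueP => x y xG yG; rewrite (G1 x y) ?eqxx.
have [b [X cX]] := cut_exists P4G G_gt1; case: b cX => cX.
  by have [] := critical_join_cases hG critG cX; auto 6.
have s_gt0 := ltnW hs.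
have [[H eH GH]|[H fH GH]] := disconnected_nonpolar_contains s_gt0 P4G cX npG.
  left; apply: (isomorphic_essential _ eH).
  exact: critical_isomorphic critG GH (essential_nonpolar _ eH).
have := critical_isomorphic critG GH (disconnected_family_nonpolar s_gt0 fH).
by case: fH => ->; auto.
Qed.
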